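(* Let $(\alpha_n)$ be a Riemann sequence, let $C$ be a constant with $|\operatorname{Im}\alpha_n|<C$ for all $n$, and let $$\zeta_\alpha(s)=\Xi_\alpha(0)\frac{\pi^{s/2}}{(s-1)\Gamma(1+s/2)}\prod_{n=1}^\infty\Bigl(1+\frac{(s-1/2)^2}{\alpha_n^2}\Bigr),$$ with $\Xi_\alpha(0)$ as defined in the context. Then $\zeta_\alpha(s)$ is a meromorphic function on $\mathbb{C}$ with a unique pole, which is simple and located at $s=1$, with residue $$\operatorname{Res}_{s=1}\zeta_\alpha(s)=2\,\Xi_\alpha(0)\prod_{n=1}^\infty\Bigl(1+\frac{1}{4\alpha_n^2}\Bigr).$$ Its zeros are the even negative integers $-2,-4,-6,\dots$ and the numbers $\tfrac12+i\alpha_n$, $\tfrac12-i\alpha_n$. These last zeros are contained in the strip $|\sigma-\tfrac12|<C$, where $\sigma=\operatorname{Re}s$. Also $\zeta_\alpha(s)$ satisfies the functional equation $$\pi^{-s/2}\Gamma(s/2)\zeta_\alpha(s)=\pi^{-(1-s)/2}\Gamma\bigl((1-s)/2\bigr)\zeta_\alpha(1-s).$$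
   Context: Asymptotic notation: for a function $f(z)$ defined on a half-plane $\operatorname{Re}z>a$, one writes $f(z)\simeq\sum_{n=0}^\infty\frac{b_n}{z^n}$ if for each natural number $N$ and any $0<\varepsilon<\frac{\pi}{2}$ we have $\lim_{z\to\infty}\bigl(f(z)-\sum_{n=0}^N\frac{b_n}{z^n}\bigr)z^N=0$ for $|\arg z|\le\frac{\pi}{2}-\varepsilon$; and $f\simeq g+\sum_n b_nz^{-n}$ means $f-g\simeq\sum_n b_nz^{-n}$. Coefficients: $a_{2n+1}=\frac{8-E_{2n}}{2^{2n+2}}$ ($n\ge0$), $a_{2n}=\bigl(1-\frac{1}{2^{2n-1}}\bigr)\frac{B_{2n}}{4n}$ ($n\ge1$), with $\frac{2e^t}{e^{2t}+1}=\sum_{n\ge0} E_n\frac{t^n}{n!}$, $\frac{t}{e^t-1}=\sum_{n\ge0} B_n\frac{t^n}{n!}$. Riemann sequence: a sequence of complex numbers $(\alpha_n)_{n\ge1}$ is a Riemann sequence if: (a) $1<\operatorname{Re}\alpha_1\le\operatorname{Re}\alpha_2\le\cdots$; (b) each complex number $\alpha$ has finite multiplicity $\nu(\alpha)=\operatorname{card}\{n:\alpha_n=\alpha\}$, and $\nu(\alpha)=\nu(\overline\alpha)$ if $\alpha$ is not real; (c) there is a constant $C$ with $|\operatorname{Im}\alpha_n|<C$ for all $n$; (d) $|\arg\alpha_n|<\pi/4$, i.e. $|\operatorname{Im}\alpha_n|<\operatorname{Re}\alpha_n$, for all $n$; (e) $\sum_{k=1}^\infty\frac{2z}{z^2+\alpha_k^2}\simeq\frac12\log\frac{z}{2\pi}+\sum_{n=1}^\infty\frac{a_n}{z^n}$.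 The constant $\Xi_\alpha(0)$: for a Riemann sequence the limit $B=\lim_{x\to+\infty}\bigl\{\sum_{n}\log(1+\frac{x^2}{\alpha_n^2})-\frac x2\log\frac{x}{2\pi}+\frac x2-\frac74\log x\bigr\}$ (principal logarithms) exists and is real, and $\Xi_\alpha(0)$ is the positive real number defined by $B=\frac14\log\frac\pi2-\log\Xi_\alpha(0)$. *)

(* Defs.v *)
(* Stdlib's real numbers with Coquelicot's complex numbers. *)
From Stdlib Require Import Reals List Factorial.
From Coquelicot Require Import Coquelicot.

Local Open Scope C_scope.

(** * Elementary complex functions *)

Definition Cexp (z : C) : C :=
  RtoC (exp (Re z)) * (cos (Im z), sin (Im z)).

(* Principal argument in (-PI, PI]; the value at 0 is irrelevant. *)
Definition Carg (z : C) : R :=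
  if Rle_dec 0 (Im z) then acos (Re z / Cmod z)
  else Ropp (acos (Re z / Cmod z)).

Definition Clog (z : C) : C := (ln (Cmod z), Carg z).

(* [x ^ z] for a real base [x > 0]. *)
Definition Rpow_C (x : R) (z : C) : C := Cexp (z * RtoC (ln x)).

(** * Limits, series and infinite products

    [iota P] is the unique element satisfying [P] when there is one. *)

Definition C_lim_along {T : Type} (F : (T -> Prop) -> Prop) (f : T -> C) : C :=
  iota (T := C_CompleteNormedModule) (fun l : C => filterlim f F (locally l)).

Definition C_series (u : nat -> C) : C :=
  iota (T := C_CompleteNormedModule) (fun l : C => is_series u l).

Fixpoint C_partial_prod (u : nat -> C) (n : nat) : C :=
  match n with
  | O => 1
  | S n' => C_partial_prod u n' * u n'
  end.

(* The limit [l] is allowed to be zero, so that an infinite product of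
   functions may be evaluated at its zeros. *)
Definition is_infprod (u : nat -> C) (l : C) : Prop :=
  filterlim (C_partial_prod u) eventually (locally l).

Definition infprod (u : nat -> C) : C :=
  iota (T := C_CompleteNormedModule) (is_infprod u).

(* Euler's limit n! n^s / (s (s+1) ... (s+n)), valid on all of C except at the
   poles 0, -1, -2, ...  At a pole the denominators are eventually 0 and, since
   [/ 0 = 0], the limit is 0; hence [/ Gamma s] is the entire function
   1/Gamma, including at the poles of Gamma. *)
Definition Gamma (s : C) : C :=
  C_lim_along eventually (fun n : nat =>
    RtoC (INR (fact n)) * Rpow_C (INR n) s
      / C_partial_prod (fun k => s + RtoC (INR k)) (S n)).

(** * Holomorphic and meromorphic functions *)

Definition holomorphic_at (f : C -> C) (z0 : C) : Prop :=
  locally z0 (fun z : C => ex_derive (K := C_AbsRing) (V := C_NormedModule) f z).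

(* The Laurent expansion of [f] at [z0] has principal part
   c_1 / (z - z0) + ... + c_m / (z - z0)^m; this is empty for m = 0. *)
Definition principal_part (f : C -> C) (z0 : C) (m : nat) (c : nat -> C) : Prop :=
  exists h : C -> C,
    holomorphic_at h z0 /\
    locally' z0 (fun z : C =>
      f z = sum_n_m (fun k => c k / (z - z0) ^ k) 1 m + h z).

Definition meromorphic (f : C -> C) : Prop :=
  forall z0 : C, exists (m : nat) (c : nat -> C), principal_part f z0 m c.

Definition pole_of_order (f : C -> C) (z0 : C) (m : nat) : Prop :=
  (1 <= m)%nat /\ exists c : nat -> C, principal_part f z0 m c /\ c m <> 0.

Definition is_pole (f : C -> C) (z0 : C) : Prop :=
  exists m : nat, pole_of_order f z0 m.

(* [1 <= m] is no restriction (pad the principal part with zeros); it makes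
   [c 1] part of the expansion. *)
Definition is_residue (f : C -> C) (z0 r : C) : Prop :=
  exists (m : nat) (c : nat -> C),
    (1 <= m)%nat /\ principal_part f z0 m c /\ c 1%nat = r.

(** * Asymptotic expansions *)

Definition C_infty : (C -> Prop) -> Prop :=
  fun P => exists M : R, forall z : C, (M < Cmod z)%R -> P z.

Definition asymptotic_expansion (f : C -> C) (b : nat -> C) : Prop :=
  forall (N : nat) (eps : R), (0 < eps < PI / 2)%R ->
    filterlim (fun z : C => (f z - sum_n (fun n => b n / z ^ n) N) * z ^ N)
      (within (fun z : C => Rabs (Carg z) <= PI / 2 - eps)%R C_infty)
      (locally (RtoC 0)).

(** * Riemann sequences *)

Definition euler_numbers (E : nat -> R) : Prop :=
  exists r : R, (0 < r)%R /\ forall t : R, (Rabs t < r)%R ->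
    is_pseries (fun n => E n / INR (fact n))%R t
      (2 * exp t / (exp (2 * t) + 1))%R.

Definition bernoulli_numbers (B : nat -> R) : Prop :=
  exists r : R, (0 < r)%R /\ forall t : R, (0 < Rabs t < r)%R ->
    is_pseries (fun n => B n / INR (fact n))%R t (t / (exp t - 1))%R.

Definition riemann_coeff (E B : nat -> R) (m : nat) : R :=
  let n := Nat.div2 m in
  match m with
  | O => 0%R
  | S _ =>
      if Nat.odd m then ((8 - E (2 * n)%nat) / 2 ^ (2 * n + 2))%R
      else ((1 - 1 / 2 ^ (2 * n - 1)) * (B (2 * n)%nat / (4 * INR n)))%R
  end.

Definition has_multiplicity (alpha : nat -> C) (a : C) (m : nat) : Prop :=
  exists l : list nat,
    NoDup l /\ length l = m /\ forall n : nat, In n l <-> alpha n = a.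

(* [alpha n] stands for the (n+1)-st term of the sequence.
   In [rs_expansion], [E] and [B] are determined by their generating functions
   and [F] is the sum of the series on the half-plane [Re z > a]. *)
Record riemann_sequence (alpha : nat -> C) : Prop := {
  rs_gt1 : (1 < Re (alpha 0%nat))%R;
  rs_mono : forall n : nat, (Re (alpha n) <= Re (alpha (S n)))%R;
  rs_mult : forall a : C, exists m : nat, has_multiplicity alpha a m;
  rs_mult_conj : forall (a : C) (m : nat), Im a <> 0%R ->
    has_multiplicity alpha a m -> has_multiplicity alpha (Cconj a) m;
  rs_strip : exists K : R, forall n : nat, (Rabs (Im (alpha n)) < K)%R;
  rs_sector : forall n : nat, (Rabs (Im (alpha n)) < Re (alpha n))%R;
  rs_expansion : exists (E B : nat -> R) (a : R) (F : C -> C),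
    euler_numbers E /\ bernoulli_numbers B /\
    (forall z : C, (a < Re z)%R ->
       is_series (fun k => 2 * z / (z ^ 2 + alpha k ^ 2)) (F z)) /\
    asymptotic_expansion
      (fun z => F z - 1 / 2 * Clog (z / RtoC (2 * PI)))
      (fun n => RtoC (riemann_coeff E B n))
}.

(** * The zeta function of a Riemann sequence *)

Definition Xi_limit (alpha : nat -> C) : C :=
  C_lim_along (Rbar_locally p_infty) (fun x : R =>
    C_series (fun n => Clog (1 + RtoC x ^ 2 / alpha n ^ 2))
      - RtoC (x / 2 * ln (x / (2 * PI)))
      + RtoC (x / 2) - RtoC (7 / 4 * ln x)).

(* The solution Xi0 > 0 of  B = 1/4 log (pi/2) - log Xi0,  where the real
   number B is [Xi_limit alpha]. *)
Definition Xi0 (alpha : nat -> C) : R :=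
  exp (1 / 4 * ln (PI / 2) - Re (Xi_limit alpha)).

Definition zeta_factor (alpha : nat -> C) (s : C) (n : nat) : C :=
  1 + (s - 1 / 2) ^ 2 / alpha n ^ 2.

(* The values at s = -2, -4, ... are those of the analytic extension,
   see [Gamma]; the value at the pole s = 1 is meaningless. *)
Definition zeta (alpha : nat -> C) (s : C) : C :=
  RtoC (Xi0 alpha)
    * (Rpow_C PI (s / 2) / ((s - 1) * Gamma (1 + s / 2)))
    * infprod (zeta_factor alpha s).

Definition is_Gamma_pole (s : C) : Prop :=
  exists k : nat, s = - RtoC (INR k).

(* Main.v *)
(* With [w = s - 1/2], convergence of the series in [rs_expansion] at a single
   large real point already forces [sum 1/|alpha_n|^2 < oo], since there all its
   terms have positive real part of order [1/(Re alpha_n)^2].  Hence the product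
   over [1 + w^2/alpha_n^2] converges to an entire function, even in [w], vanishing
   only where a factor does.  Likewise
     1/Gamma(s) = s (1+s) prod_{k>=2} (1+s/k) (1-1/k)^s
   is entire with zeros [0, -1, -2, ...].  So [zeta] is an entire function over
   [s - 1], and the functional equation is evenness in [w] together with
   [Gamma(1+s/2) = (s/2) Gamma(s/2)]; the residue needs [Gamma(3/2) = sqrt(pi)/2],
   which is Wallis' formula.

   To avoid Cauchy's theory, holomorphy is replaced by a second-order Taylor
   expansion with cubic remainder at every point.  This passes to products and to
   infinite products, and it is enough to make the difference quotient at [s = 1],
   hence [zeta] minus its principal part, complex differentiable at [1] itself. *)
Require Import Defs.
From Stdlib Require Import Reals List Factorial Lra Lia.
From Stdlib Require Import Classical FunctionalExtensionality.
From Coquelicot Require Import Coquelicot.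

Local Open Scope R_scope.
Local Open Scope C_scope.

(** * Complex sequences *)

(** A jet with cubic remainder survives a pointwise limit as soon as its radius and its remainder
    constant are uniform. The uniform constant comes from the size [|p0| + |p1| + |p2| + M] of a
    jet: on discs of radius at most 1 it is submultiplicative, so factors of size at most
    [1 + 4 * d n], with [d] summable, keep every partial product below [exp (4 * Series d)]. Order
    two is forced by the pole: dividing by [z - z0] costs one order, and what remains must still
    yield a derivative at [z0]. In the product for 1/Gamma, (1 - 1/k)^s cancels the first-order term
    of 1 + s/k, which brings the factors summably close to 1, and it telescopes to the power in
    Euler's limit. Working with 1/Gamma fits the convention [/ 0 = 0]: identities between
    reciprocals hold at the poles of Gamma too. *)

Lemma Csub_neq_0 (a b : C) : a <> b -> a - b <> 0.
Proof. intros H E. apply H. replace a with (a - b + b) by ring. rewrite E. ring. Qed.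

Lemma ball_of_Cmod (x y : C) (eps : R) : Cmod (y - x) < eps -> ball x eps y.
Proof. exact (C_NormedModule_mixin_compat1 x y eps). Qed.

Lemma Cmod_of_ball (x y : C) (eps : posreal) :
  ball (x : C_UniformSpace) eps y -> Cmod (y - x) < sqrt 2 * eps.
Proof. exact (C_NormedModule_mixin_compat2 x y eps). Qed.

(** [ball] on [C] is a square, from the product uniform structure, while the estimates below use
    discs; both generate the same filter, at the cost of a factor [sqrt 2]. *)
Lemma locally_Cmod (z : C) (P : C -> Prop) :
  locally z P <-> exists d : R, 0 < d /\ forall w : C, Cmod (w - z) < d -> P w.
Proof.
  split.
  - intros [e He]. exists e. split; [apply cond_pos|].
    intros w Hw. apply He, ball_of_Cmod, Hw.
  - intros [d [Hd H]].
    assert (H2 : 0 < sqrt 2) by (apply sqrt_lt_R0; lra).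
    assert (Hp : 0 < d / sqrt 2) by (apply Rdiv_lt_0_compat; lra).
    exists (mkposreal _ Hp). intros w Hw. apply H.
    apply Cmod_of_ball in Hw. simpl in Hw.
    replace (sqrt 2 * (d / sqrt 2))%R with d in Hw; [exact Hw|field; lra].
Qed.

Lemma filterlim_locally_Cmod {T : Type} (F : (T -> Prop) -> Prop) {FF : Filter F}
    (f : T -> C) (l : C) :
  filterlim f F (locally l) <->
  forall eps : R, 0 < eps -> F (fun t => Cmod (f t - l) < eps).
Proof.
  split.
  - intros H eps Heps. apply (H (fun w => Cmod (w - l) < eps)).
    apply locally_Cmod. exists eps. auto.
  - intros H P HP. apply locally_Cmod in HP. destruct HP as [d [Hd HP]].
    unfold filtermap. generalize (H d Hd). apply filter_imp. intros t Ht. apply HP, Ht.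
Qed.

Definition Clim (u : nat -> C) (l : C) : Prop :=
  filterlim u eventually (locally l).

Lemma Clim_Cmod (u : nat -> C) (l : C) :
  Clim u l <-> forall eps : R, 0 < eps -> eventually (fun n => Cmod (u n - l) < eps).
Proof. apply filterlim_locally_Cmod, eventually_filter. Qed.

Lemma Clim_unique (u : nat -> C) (l l' : C) : Clim u l -> Clim u l' -> l = l'.
Proof.
  exact (filterlim_locally_unique (V := C_NormedModule) (F := eventually) u l l').
Qed.

Lemma Clim_const (c : C) : Clim (fun _ => c) c.
Proof. apply filterlim_const. Qed.

Lemma Clim_ext_eventually (u v : nat -> C) (l : C) :
  eventually (fun n => u n = v n) -> Clim u l -> Clim v l.
Proof. intros H. apply filterlim_ext_loc, H. Qed.

Lemma Clim_ext (u v : nat -> C) (l : C) :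
  (forall n, u n = v n) -> Clim u l -> Clim v l.
Proof. intros H. apply Clim_ext_eventually. exists 0%nat. auto. Qed.

Lemma Clim_RtoC (u : nat -> R) (l : R) :
  is_lim_seq u l -> Clim (fun n => RtoC (u n)) (RtoC l).
Proof.
  intros H. apply Clim_Cmod. intros eps Heps.
  apply is_lim_seq_spec in H. generalize (H (mkposreal eps Heps)).
  apply filter_imp. intros n Hn. rewrite <- RtoC_minus, Cmod_R. exact Hn.
Qed.

Lemma Clim_S (u : nat -> C) (l : C) : Clim (fun n => u (S n)) l -> Clim u l.
Proof.
  rewrite !Clim_Cmod. intros H eps Heps. destruct (H eps Heps) as [N HN].
  exists (S N). intros [|n] Hn; [lia|]. apply HN. lia.
Qed.

Lemma Clim_plus (u v : nat -> C) (l m : C) :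
  Clim u l -> Clim v m -> Clim (fun n => u n + v n) (l + m).
Proof.
  rewrite !Clim_Cmod. intros Hu Hv eps Heps.
  generalize (filter_and (F := eventually) _ _
                (Hu (eps / 2)%R ltac:(lra)) (Hv (eps / 2)%R ltac:(lra))).
  apply filter_imp. intros n [H1 H2].
  replace (u n + v n - (l + m)) with ((u n - l) + (v n - m)) by ring.
  generalize (Cmod_triangle (u n - l) (v n - m)). lra.
Qed.

Lemma Clim_mult (u v : nat -> C) (l m : C) :
  Clim u l -> Clim v m -> Clim (fun n => u n * v n) (l * m).
Proof.
  rewrite !Clim_Cmod. intros Hu Hv eps Heps.
  assert (Hl := Cmod_ge_0 l). assert (Hm := Cmod_ge_0 m).
  (* With [e <= 1] the three error terms add up to at most [e * (1 + Cmod l + Cmod m)]; the 2 in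
     place of 1 makes the final inequality strict. *)
  set (e := Rmin 1 (eps / (Cmod l + Cmod m + 2))).
  assert (He : 0 < e).
  { apply Rmin_glb_lt; [lra|]. apply Rdiv_lt_0_compat; lra. }
  assert (He1 : e <= 1) by apply Rmin_l.
  assert (He2 : e * (Cmod l + Cmod m + 2) <= eps).
  { apply Rle_trans with (eps / (Cmod l + Cmod m + 2) * (Cmod l + Cmod m + 2))%R.
    - apply Rmult_le_compat_r; [lra|apply Rmin_r].
    - right. field. lra. }
  generalize (filter_and (F := eventually) _ _ (Hu e He) (Hv e He)).
  apply filter_imp. intros n [H1 H2].
  replace (u n * v n - l * m)
    with ((u n - l) * (v n - m) + ((u n - l) * m + l * (v n - m))) by ring.
  eapply Rle_lt_trans; [apply Cmod_triangle|].
  eapply Rle_lt_trans; [apply Rplus_le_compat_l, Cmod_triangle|].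
  rewrite !Cmod_mult.
  assert (H3 := Cmod_ge_0 (u n - l)). assert (H4 := Cmod_ge_0 (v n - m)).
  nra.
Qed.

Lemma Clim_inv (u : nat -> C) (l : C) :
  l <> 0 -> Clim u l -> Clim (fun n => / u n) (/ l).
Proof.
  rewrite !Clim_Cmod. intros Hl Hu eps Heps.
  assert (Hl' := proj1 (Cmod_gt_0 l) Hl).
  set (e := Rmin (Cmod l / 2) (eps * (Cmod l * Cmod l) / 2)).
  assert (He : 0 < e).
  { apply Rmin_glb_lt; [lra|]. apply Rdiv_lt_0_compat; [|lra].
    apply Rmult_lt_0_compat; [lra|nra]. }
  generalize (Hu e He). apply filter_imp. intros n Hn.
  assert (H1 : Cmod (u n - l) < Cmod l / 2).
  { eapply Rlt_le_trans; [exact Hn|apply Rmin_l]. }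
  assert (H2 : Cmod (u n - l) < eps * (Cmod l * Cmod l) / 2).
  { eapply Rlt_le_trans; [exact Hn|apply Rmin_r]. }
  assert (H3 : Cmod l / 2 < Cmod (u n)).
  { generalize (Cmod_triangle (u n) (- (u n - l))).
    rewrite Cmod_opp. replace (u n + - (u n - l)) with l by ring. lra. }
  assert (Hun : u n <> 0) by (apply Cmod_gt_0; lra).
  replace (/ u n - / l) with (- (u n - l) * / (u n * l)) by (field; auto).
  rewrite Cmod_mult, Cmod_opp, Cmod_inv, Cmod_mult
    by (apply Cmult_neq_0; assumption).
  assert (H4 : 0 < Cmod (u n) * Cmod l) by nra.
  apply Rmult_lt_reg_r with (Cmod (u n) * Cmod l)%R; [exact H4|].
  replace (Cmod (u n - l) * / (Cmod (u n) * Cmod l) * (Cmod (u n) * Cmod l))%R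
    with (Cmod (u n - l)) by (field; split; lra).
  assert (H5 : eps * (Cmod l / 2 * Cmod l) < eps * (Cmod (u n) * Cmod l)).
  { apply Rmult_lt_compat_l; [lra|]. nra. }
  lra.
Qed.

Lemma Clim_Cmod_le (u : nat -> C) (l : C) (M : R) :
  (forall n, Cmod (u n) <= M) -> Clim u l -> Cmod l <= M.
Proof.
  rewrite Clim_Cmod. intros HM Hu. apply Rnot_lt_le. intros Hlt.
  destruct (Hu (Cmod l - M)%R ltac:(lra)) as [N HN].
  specialize (HN N (Nat.le_refl N)). specialize (HM N).
  generalize (Cmod_triangle (u N) (- (u N - l))).
  rewrite Cmod_opp. replace (u N + - (u N - l)) with l by ring. lra.
Qed.

Lemma Clim_Cmod_ge (u : nat -> C) (l : C) (m : R) :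
  eventually (fun n => m <= Cmod (u n)) -> Clim u l -> m <= Cmod l.
Proof.
  rewrite Clim_Cmod. intros HM Hu. apply Rnot_lt_le. intros Hlt.
  destruct (filter_and (F := eventually) _ _ HM (Hu (m - Cmod l)%R ltac:(lra))) as [N HN].
  destruct (HN N (Nat.le_refl N)) as [H1 H2].
  generalize (Cmod_triangle l (u N - l)).
  replace (l + (u N - l)) with (u N) by ring. lra.
Qed.

(** The increments form an absolutely convergent series, whose partial sums telescope to
    [u (S n) - u 0]. *)
Lemma Clim_of_summable_increments (u : nat -> C) (e : nat -> R) :
  (forall n, Cmod (u (S n) - u n) <= e n) -> ex_series e -> exists l, Clim u l.
Proof.
  intros H He.
  destruct (ex_series_le (V := C_CompleteNormedModule)
              (fun n => u (S n) - u n) e) as [l Hl].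
  - exact H.
  - exact He.
  - exists (l + u 0%nat). apply Clim_S.
    apply Clim_ext with
      (fun n => sum_n (G := C_AbelianMonoid) (fun k => u (S k) - u k) n + u 0%nat).
    + intros n. induction n as [|n IH].
      * rewrite sum_O. ring.
      * rewrite sum_Sn. change plus with Cplus.
        replace (sum_n (G := C_AbelianMonoid) (fun k => u (S k) - u k) n)
          with (u (S n) - u 0%nat) by (rewrite <- IH; ring).
        ring.
    + apply Clim_plus; [exact Hl|apply Clim_const].
Qed.

Lemma is_infprod_unique (u : nat -> C) (l : C) : is_infprod u l -> infprod u = l.
Proof.
  intros H. unfold infprod, is_infprod.
  apply (iota_filterlim_locally (V := C_CompleteNormedModule) (C_partial_prod u) l).
  exact H.
Qed.

(** * Infinite products *)

Lemma Cmod_sub1_ge (u : C) : 1 - Cmod (u - 1) <= Cmod u.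
Proof.
  generalize (Cmod_triangle u (- (u - 1))). rewrite Cmod_opp.
  replace (u + - (u - 1)) with (RtoC 1) by ring. rewrite Cmod_1. lra.
Qed.

Lemma C_partial_prod_eq_0 (u : nat -> C) (k n : nat) :
  u k = 0 -> (k < n)%nat -> C_partial_prod u n = 0.
Proof.
  intros Hk. induction n as [|n IH]; intros Hn; [lia|]. simpl.
  destruct (Nat.eq_dec k n) as [<-|Hne].
  - rewrite Hk. ring.
  - rewrite IH by lia. ring.
Qed.

Lemma C_partial_prod_neq_0 (u : nat -> C) (n : nat) :
  (forall k, u k <> 0) -> C_partial_prod u n <> 0.
Proof.
  intros H. induction n as [|n IH]; simpl.
  - intros E. apply (f_equal Cmod) in E. rewrite Cmod_1, Cmod_0 in E. lra.
  - apply Cmult_neq_0; auto.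
Qed.

Lemma is_infprod_eq_0 (u : nat -> C) (k : nat) (l : C) :
  u k = 0 -> is_infprod u l -> l = 0.
Proof.
  intros Hk Hl. apply (Clim_unique (C_partial_prod u)); [exact Hl|].
  apply Clim_ext_eventually with (fun _ => RtoC 0); [|apply Clim_const].
  exists (S k). intros n Hn. symmetry. apply C_partial_prod_eq_0 with k; [exact Hk|lia].
Qed.

(** Beyond an index [N] where the remaining [d] sum to at most 1/2, the Weierstrass inequality prod
    (1 - d k) >= 1 - sum d k keeps the partial products at or above half the modulus of the product
    of the first [N] factors. *)
Lemma is_infprod_neq_0 (u : nat -> C) (d : nat -> R) (l : C) :
  (forall n, Cmod (u n - 1) <= d n) -> ex_series d -> (forall n, u n <> 0) ->
  is_infprod u l -> l <> 0.
Proof.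
  intros Hd Hs Hu Hl.
  assert (Hd0 : forall n, 0 <= d n).
  { intros n. eapply Rle_trans; [apply Cmod_ge_0|apply Hd]. }
  assert (HC : exists N, forall m, sum_n_m d N (N + m) <= / 2).
  { apply (Cauchy_ex_series (V := R_CompleteNormedModule)) in Hs.
    destruct (Hs (mkposreal (/ 2) ltac:(lra))) as [N HN].
    exists N. intros m. specialize (HN N (N + m)%nat ltac:(lia) ltac:(lia)).
    simpl in HN. left. eapply Rle_lt_trans; [apply Rle_abs|exact HN]. }
  destruct HC as [N HN].
  set (p := Cmod (C_partial_prod u N)).
  assert (Hp : 0 < p) by (apply Cmod_gt_0, C_partial_prod_neq_0, Hu).
  assert (Hm : forall m, p * (1 - sum_n_m d N (N + m))
                         <= Cmod (C_partial_prod u (S (N + m)))).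
  { assert (Hu1 : forall n, 1 - d n <= Cmod (u n)).
    { intros n. generalize (Cmod_sub1_ge (u n)) (Hd n). lra. }
    induction m as [|m IH].
    - rewrite Nat.add_0_r, sum_n_n. simpl. rewrite Cmod_mult. fold p.
      apply Rmult_le_compat_l; [lra|apply Hu1].
    - generalize (HN m) (HN (S m)). rewrite Nat.add_succ_r.
      rewrite sum_n_Sm by lia. change plus with Rplus. intros H1 H2.
      change (C_partial_prod u (S (S (N + m))))
        with (C_partial_prod u (S (N + m)) * u (S (N + m))).
      rewrite Cmod_mult.
      assert (H3 := Hu1 (S (N + m))). assert (H4 := Hd0 (S (N + m))).
      assert (H5 : 0 <= sum_n_m d N (N + m)).
      { eapply Rle_trans; [right|apply (sum_n_m_le (fun _ => 0%R)), Hd0].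
        symmetry. apply (sum_n_m_const_zero (G := R_AbelianGroup)). }
      apply Rle_trans with (p * (1 - sum_n_m d N (N + m)) * (1 - d (S (N + m))))%R.
      + rewrite Rmult_assoc. apply Rmult_le_compat_l; [lra|]. nra.
      + apply Rmult_le_compat; [|lra|exact IH|exact H3].
        apply Rmult_le_pos; lra. }
  apply Cmod_gt_0. apply Rlt_le_trans with (p / 2)%R; [lra|].
  apply Clim_Cmod_ge with (C_partial_prod u); [|exact Hl].
  exists (S N). intros n Hn.
  replace n with (S (N + (n - S N)))%nat by lia.
  eapply Rle_trans; [|apply Hm]. generalize (HN (n - S N)%nat). nra.
Qed.

(** * Second-order jets *)

Lemma Cmod_plus_le (x y : C) (a b : R) :
  Cmod x <= a -> Cmod y <= b -> Cmod (x + y) <= a + b.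
Proof. generalize (Cmod_triangle x y). lra. Qed.

Lemma Cmod_mult_le (x y : C) (a b : R) :
  Cmod x <= a -> Cmod y <= b -> Cmod (x * y) <= a * b.
Proof.
  intros Hx Hy. rewrite Cmod_mult.
  apply Rmult_le_compat; auto using Cmod_ge_0.
Qed.

(** Radius and remainder constant are explicit so that one pair can serve all partial products of an
    infinite product. *)
Definition jet (f : C -> C) (z0 : C) (r : R) (c0 c1 c2 : C) (M : R) : Prop :=
  forall t : C, Cmod t <= r ->
    Cmod (f (z0 + t) - (c0 + c1 * t + c2 * (t * t))) <= M * Cmod t ^ 3.

(** [r <= 1] lets powers of [t] above the third be absorbed in the cubic remainder when jets are
    multiplied. *)
Definition taylor2 (f : C -> C) (z0 : C) : Prop :=
  exists (r : R) (c0 c1 c2 : C) (M : R),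
    0 < r <= 1 /\ 0 <= M /\ jet f z0 r c0 c1 c2 M.

Lemma jet_center (f : C -> C) (z0 c0 c1 c2 : C) (r M : R) :
  0 <= r -> jet f z0 r c0 c1 c2 M -> f z0 = c0.
Proof.
  intros Hr H. specialize (H 0). rewrite Cmod_0 in H. specialize (H Hr).
  replace (z0 + 0) with z0 in H by ring.
  replace (f z0 - (c0 + c1 * 0 + c2 * (0 * 0))) with (f z0 - c0) in H by ring.
  assert (H0 : Cmod (f z0 - c0) = 0%R) by (generalize (Cmod_ge_0 (f z0 - c0)); nra).
  apply Cmod_eq_0 in H0.
  replace (f z0) with ((f z0 - c0) + c0) by ring. rewrite H0. ring.
Qed.

Lemma jet_poly (f : C -> C) (z0 c0 c1 c2 : C) (r : R) :
  (forall t, f (z0 + t) = c0 + c1 * t + c2 * (t * t)) -> jet f z0 r c0 c1 c2 0.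
Proof.
  intros H t _. rewrite H.
  replace (_ - _) with (RtoC 0) by ring. rewrite Cmod_0. lra.
Qed.

(** The constant collects the remainder of [f] times all of [g], the terms of degree 3 and 4 in the
    product of the polynomials, and the polynomial of [f] times the remainder of [g]. Added to the
    moduli of the new coefficients, it is at most the product of the two sizes
    [Cmod p0 + Cmod p1 + Cmod p2 + M] and [Cmod q0 + Cmod q1 + Cmod q2 + N]. *)
Lemma jet_mult (f g : C -> C) (z0 p0 p1 p2 q0 q1 q2 : C) (r M N : R) :
  r <= 1 -> 0 <= M -> 0 <= N ->
  jet f z0 r p0 p1 p2 M -> jet g z0 r q0 q1 q2 N ->
  jet (fun z => f z * g z) z0 r (p0 * q0) (p1 * q0 + p0 * q1)
    (p2 * q0 + p1 * q1 + p0 * q2)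
    (M * (Cmod q0 + Cmod q1 + Cmod q2 + N)
     + (Cmod p2 * Cmod q1 + Cmod p1 * Cmod q2 + Cmod p2 * Cmod q2)
     + (Cmod p0 + Cmod p1 + Cmod p2) * N).
Proof.
  intros Hr HM HN Hf Hg t Ht. specialize (Hf t Ht). specialize (Hg t Ht).
  set (F := f (z0 + t)) in *. set (G := g (z0 + t)) in *.
  set (rho := F - (p0 + p1 * t + p2 * (t * t))) in *.
  set (sig := G - (q0 + q1 * t + q2 * (t * t))) in *.
  replace (F * G - (p0 * q0 + (p1 * q0 + p0 * q1) * t
             + (p2 * q0 + p1 * q1 + p0 * q2) * (t * t)))
    with (rho * (q0 + q1 * t + q2 * (t * t) + sig)
          + (p2 * q1 + p1 * q2 + p2 * q2 * t) * (t * t * t)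
          + (p0 + p1 * t + p2 * (t * t)) * sig) by (unfold rho, sig; ring).
  set (T := Cmod t) in *.
  assert (HT : 0 <= T <= 1) by (split; [apply Cmod_ge_0|lra]).
  assert (HT2 : 0 <= T * T <= 1) by nra.
  assert (HT3 : 0 <= T ^ 3 <= 1) by (simpl; nra).
  assert (Hc : forall c, Cmod (c * t) <= Cmod c).
  { intros c. rewrite Cmod_mult. fold T. generalize (Cmod_ge_0 c). nra. }
  assert (Hc2 : forall c, Cmod (c * (t * t)) <= Cmod c).
  { intros c. rewrite !Cmod_mult. fold T. generalize (Cmod_ge_0 c). nra. }
  assert (Hq : Cmod (q0 + q1 * t + q2 * (t * t) + sig)
               <= Cmod q0 + Cmod q1 + Cmod q2 + N).
  { repeat apply Cmod_plus_le; auto; [lra|].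
    eapply Rle_trans; [exact Hg|]. nra. }
  assert (Hp : Cmod (p0 + p1 * t + p2 * (t * t)) <= Cmod p0 + Cmod p1 + Cmod p2).
  { repeat apply Cmod_plus_le; auto. lra. }
  assert (Hpq : Cmod (p2 * q1 + p1 * q2 + p2 * q2 * t)
                <= Cmod p2 * Cmod q1 + Cmod p1 * Cmod q2 + Cmod p2 * Cmod q2).
  { repeat apply Cmod_plus_le; try (rewrite Cmod_mult; lra).
    rewrite <- Cmod_mult. auto. }
  assert (Ht3 : Cmod (t * t * t) <= T ^ 3).
  { rewrite !Cmod_mult. fold T. simpl. lra. }
  eapply Rle_trans.
  - apply Cmod_plus_le; [apply Cmod_plus_le|]; apply Cmod_mult_le; eassumption.
  - right. ring.
Qed.

Lemma jet_ext (f g : C -> C) (z0 c0 c1 c2 : C) (r M : R) :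
  (forall z, f z = g z) -> jet f z0 r c0 c1 c2 M -> jet g z0 r c0 c1 c2 M.
Proof. intros E H t Ht. rewrite <- E. apply H, Ht. Qed.

Lemma jet_weaken (f : C -> C) (z0 c0 c1 c2 : C) (r r' M M' : R) :
  r' <= r -> M <= M' -> jet f z0 r c0 c1 c2 M -> jet f z0 r' c0 c1 c2 M'.
Proof.
  intros Hr HM H t Ht. eapply Rle_trans; [apply H; lra|].
  apply Rmult_le_compat_r; [apply pow_le, Cmod_ge_0|exact HM].
Qed.

Lemma taylor2_ext (f g : C -> C) (z0 : C) :
  (forall z, f z = g z) -> taylor2 f z0 -> taylor2 g z0.
Proof.
  intros E (r & c0 & c1 & c2 & M & Hr & HM & H).
  exists r, c0, c1, c2, M. repeat split; try tauto. now apply jet_ext with f.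
Qed.

Lemma taylor2_mult (f g : C -> C) (z0 : C) :
  taylor2 f z0 -> taylor2 g z0 -> taylor2 (fun z => f z * g z) z0.
Proof.
  intros (r & p0 & p1 & p2 & M & Hr & HM & Hf) (s & q0 & q1 & q2 & N & Hs & HN & Hg).
  do 5 eexists. split; [|split].
  3: { apply (jet_mult f g z0 p0 p1 p2 q0 q1 q2 (Rmin r s) M N); try assumption.
       - generalize (Rmin_l r s). lra.
       - eapply jet_weaken; [apply Rmin_l|apply Rle_refl|exact Hf].
       - eapply jet_weaken; [apply Rmin_r|apply Rle_refl|exact Hg]. }
  - split; [apply Rmin_glb_lt; lra|generalize (Rmin_l r s); lra].
  - repeat apply Rplus_le_le_0_compat; apply Rmult_le_pos;
      repeat apply Rplus_le_le_0_compat; auto using Cmod_ge_0.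
Qed.

Lemma taylor2_affine (a b z0 : C) : taylor2 (fun z => a * z + b) z0.
Proof.
  exists 1%R, (a * z0 + b), a, 0, 0%R.
  split; [lra|split; [lra|]]. apply jet_poly. intros t. ring.
Qed.

Lemma taylor2_const (c z0 : C) : taylor2 (fun _ => c) z0.
Proof.
  apply taylor2_ext with (fun z => 0 * z + c); [intros z; ring|apply taylor2_affine].
Qed.

Lemma taylor2_comp_affine (f : C -> C) (a b z0 : C) :
  Cmod a <= 1 -> taylor2 f (a * z0 + b) -> taylor2 (fun z => f (a * z + b)) z0.
Proof.
  intros Ha (r & c0 & c1 & c2 & M & Hr & HM & H).
  exists r, c0, (c1 * a), (c2 * (a * a)), M. split; [exact Hr|split; [exact HM|]].
  intros t Ht.
  assert (Hat : Cmod (a * t) <= Cmod t).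
  { rewrite Cmod_mult. generalize (Cmod_ge_0 t). nra. }
  replace (a * (z0 + t) + b) with (a * z0 + b + a * t) by ring.
  replace (c0 + c1 * a * t + c2 * (a * a) * (t * t))
    with (c0 + c1 * (a * t) + c2 * (a * t * (a * t))) by ring.
  eapply Rle_trans; [apply H; lra|].
  apply Rmult_le_compat_l; [exact HM|]. apply pow_incr. auto using Cmod_ge_0.
Qed.

Lemma taylor2_inv_sub (a z0 : C) : z0 <> a -> taylor2 (fun z => / (z - a)) z0.
Proof.
  intros Hne. set (w := z0 - a).
  assert (Hw : w <> 0) by apply Csub_neq_0, Hne.
  assert (Hw' := proj1 (Cmod_gt_0 w) Hw).
  exists (Rmin 1 (Cmod w / 2)), (/ w), (- / (w * w)), (/ (w * w * w)),
    (/ (Cmod w * Cmod w * Cmod w * (Cmod w / 2)))%R.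
  assert (HM : 0 < Cmod w * Cmod w * Cmod w * (Cmod w / 2)).
  { repeat apply Rmult_lt_0_compat; lra. }
  split; [split; [apply Rmin_glb_lt; lra|apply Rmin_l]|].
  split; [left; apply Rinv_0_lt_compat, HM|].
  intros t Ht.
  assert (Ht' : Cmod t <= Cmod w / 2).
  { eapply Rle_trans; [exact Ht|apply Rmin_r]. }
  assert (Hwt : Cmod w / 2 <= Cmod (w + t)).
  { generalize (Cmod_triangle (w + t) (- t)). rewrite Cmod_opp.
    replace (w + t + - t) with w by ring. lra. }
  assert (Hwt0 : w + t <> 0) by (apply Cmod_gt_0; lra).
  replace (z0 + t - a) with (w + t) by (unfold w; ring).
  (* The geometric expansion of 1/(w + t) stopped at order two has the exact remainder -t^3/(w^3 (w
     + t)), and the radius keeps [Cmod (w + t)] at least half of [Cmod w]. *)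
  replace (/ (w + t) - (/ w + - / (w * w) * t + / (w * w * w) * (t * t)))
    with (- (/ (w * w * w * (w + t)) * (t * t * t))) by (field; auto).
  rewrite Cmod_opp, Cmod_mult, Cmod_inv, !Cmod_mult
    by (repeat apply Cmult_neq_0; assumption).
  replace (Cmod t * Cmod t * Cmod t)%R with (Cmod t ^ 3)%R by (simpl; ring).
  apply Rmult_le_compat_r; [apply pow_le, Cmod_ge_0|].
  apply Rinv_le_contravar; [exact HM|].
  apply Rmult_le_compat_l; [|exact Hwt].
  repeat apply Rmult_le_pos; lra.
Qed.

Lemma ex_derive_of_quadratic_remainder (f : C -> C) (z0 l : C) (r M : R) :
  0 < r -> 0 <= M ->
  (forall t, Cmod t < r -> Cmod (f (z0 + t) - f z0 - l * t) <= M * Cmod t ^ 2) ->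
  ex_derive (K := C_AbsRing) (V := C_NormedModule) f z0.
Proof.
  intros Hr HM H. exists l. split; [apply is_linear_scal_l|].
  (* Differentiability asks for the estimate at every limit [x] of the neighbourhood filter, and
     [z0] is the only one. *)
  intros x Hx.
  apply (is_filter_lim_locally_unique (V := AbsRing_NormedModule C_AbsRing)) in Hx.
  subst x. intros eps.
  assert (He := cond_pos eps).
  apply (locally_norm_le_locally (V := AbsRing_NormedModule C_AbsRing)).
  assert (Hd : 0 < Rmin r (eps / (M + 1))).
  { apply Rmin_glb_lt; [exact Hr|]. apply Rdiv_lt_0_compat; lra. }
  exists (mkposreal _ Hd). intros y Hy.
  change (Cmod (y - z0) < Rmin r (eps / (M + 1))) in Hy.
  change (Cmod (f y - f z0 - (y - z0) * l) <= eps * Cmod (y - z0)).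
  set (t := y - z0) in *.
  replace y with (z0 + t) by (unfold t; ring).
  replace (t * l) with (l * t) by ring.
  assert (H1 : Cmod t < r) by (eapply Rlt_le_trans; [exact Hy|apply Rmin_l]).
  assert (H2 : Cmod t < eps / (M + 1)) by (eapply Rlt_le_trans; [exact Hy|apply Rmin_r]).
  eapply Rle_trans; [apply H, H1|].
  assert (H3 : Cmod t * (M + 1) < eps).
  { apply Rmult_lt_compat_r with (r := (M + 1)%R) in H2; [|lra].
    replace (eps / (M + 1) * (M + 1))%R with (pos eps) in H2 by (field; lra).
    exact H2. }
  generalize (Cmod_ge_0 t). intros H4. simpl. nra.
Qed.

Lemma taylor2_ex_derive (f : C -> C) (z0 : C) :
  taylor2 f z0 -> ex_derive (K := C_AbsRing) (V := C_NormedModule) f z0.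
Proof.
  intros (r & c0 & c1 & c2 & M & Hr & HM & H).
  assert (H0 : f z0 = c0) by (apply (jet_center f z0 c0 c1 c2 r M); [lra|exact H]).
  assert (H2 := Cmod_ge_0 c2).
  apply (ex_derive_of_quadratic_remainder f z0 c1 r (Cmod c2 + M)); [lra|lra|].
  intros t Ht. rewrite H0.
  replace (f (z0 + t) - c0 - c1 * t)
    with ((f (z0 + t) - (c0 + c1 * t + c2 * (t * t))) + c2 * (t * t)) by ring.
  eapply Rle_trans.
  { apply Cmod_plus_le; [apply H; lra|]. rewrite !Cmod_mult. apply Rle_refl. }
  assert (Ht0 := Cmod_ge_0 t). simpl.
  assert (Ht2 : Cmod t * (Cmod t * 1) <= 1 * 1) by (apply Rmult_le_compat; nra).
  assert (Ht3 : Cmod t * (Cmod t * (Cmod t * 1)) <= Cmod t * (Cmod t * 1)) by nra.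
  nra.
Qed.

Lemma Ceq_or_neq (x y : C) : {x = y} + {x <> y}.
Proof.
  destruct x as [a b], y as [c d].
  destruct (Req_dec_T a c) as [->|]; [|right; congruence].
  destruct (Req_dec_T b d) as [->|]; [left|right]; congruence.
Qed.

(* The removable singularity of the difference quotient: differentiability of
   the quotient at [z0] itself is what the second-order jet is for. *)
Lemma taylor2_difference_quotient (f : C -> C) (z0 : C) :
  (forall z, taylor2 f z) ->
  exists h : C -> C,
    (forall z, ex_derive (K := C_AbsRing) (V := C_NormedModule) h z) /\
    (forall z, f z = f z0 + (z - z0) * h z).
Proof.
  intros Hf. destruct (Hf z0) as (r & c0 & c1 & c2 & M & Hr & HM & H).
  assert (H0 : f z0 = c0) by (apply (jet_center f z0 c0 c1 c2 r M); [lra|exact H]).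
  (* The first-order coefficient [c1] is the value that fills the singularity. *)
  set (h := fun z => if Ceq_or_neq z z0 then c1 else (f z - f z0) / (z - z0)).
  exists h. split.
  - intros z. destruct (Ceq_or_neq z z0) as [->|Hz].
    + apply (ex_derive_of_quadratic_remainder h z0 c2 r M); [lra|lra|].
      intros t Ht. unfold h at 2. destruct (Ceq_or_neq z0 z0) as [_|]; [|congruence].
      destruct (Ceq_or_neq t 0) as [->|Ht0].
      * replace (z0 + 0) with z0 by ring. unfold h.
        destruct (Ceq_or_neq z0 z0) as [_|]; [|congruence].
        replace (c1 - c1 - c2 * 0) with (RtoC 0) by ring. rewrite Cmod_0.
        simpl. lra.
      * unfold h. destruct (Ceq_or_neq (z0 + t) z0) as [E|_].
        { exfalso. apply Ht0. replace t with (z0 + t - z0) by ring. rewrite E. ring. }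
        assert (Ht' := proj1 (Cmod_gt_0 t) Ht0).
        (* Dividing the cubic remainder of [f] by [t] leaves a quadratic one for [h], with
           derivative [c2] at [z0]. *)
        replace ((f (z0 + t) - f z0) / (z0 + t - z0) - c1 - c2 * t)
          with ((f (z0 + t) - (c0 + c1 * t + c2 * (t * t))) / t).
        2: { rewrite H0. replace (z0 + t - z0) with t by ring. field. exact Ht0. }
        rewrite Cmod_div by exact Ht0.
        apply Rmult_le_reg_r with (Cmod t); [exact Ht'|].
        unfold Rdiv. rewrite Rmult_assoc, Rinv_l by lra. rewrite Rmult_1_r.
        eapply Rle_trans; [apply H; lra|]. right. simpl. ring.
    (* Elsewhere [h] coincides, on the disc around [z] that stops at [z0], with a product of two
       functions having jets. *)
    + assert (HT : taylor2 (fun z => (f z + - f z0) * / (z - z0)) z).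
      { apply taylor2_mult; [|apply taylor2_inv_sub, Hz].
        destruct (Hf z) as (r' & b0 & b1 & b2 & M' & Hr' & HM' & H').
        exists r', (b0 - f z0), b1, b2, M'. split; [exact Hr'|split; [exact HM'|]].
        intros t Ht.
        replace (f (z + t) + - f z0 - (b0 - f z0 + b1 * t + b2 * (t * t)))
          with (f (z + t) - (b0 + b1 * t + b2 * (t * t))) by ring.
        apply H', Ht. }
      apply taylor2_ex_derive in HT. revert HT.
      apply (ex_derive_ext_loc (K := C_AbsRing) (V := C_NormedModule)).
      apply (locally_norm_le_locally (V := AbsRing_NormedModule C_AbsRing)).
      assert (Hd : 0 < Cmod (z - z0)).
      { apply Cmod_gt_0, Csub_neq_0, Hz. }
      exists (mkposreal _ Hd). intros y Hy.
      change (Cmod (y - z) < Cmod (z - z0)) in Hy.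
      unfold h. destruct (Ceq_or_neq y z0) as [->|_]; [|reflexivity].
      exfalso. rewrite <- Cmod_opp in Hy.
      replace (- (z0 - z)) with (z - z0) in Hy by ring. lra.
  - intros z. unfold h. destruct (Ceq_or_neq z z0) as [->|Hz]; [ring|].
    field. apply Csub_neq_0, Hz.
Qed.

(* [1 + c n], [a n], [b n] are the jet coefficients of the [n]-th factor. *)
Fixpoint prod_jet (c a b : nat -> C) (n : nat) : C * C * C :=
  match n with
  | O => (RtoC 1, RtoC 0, RtoC 0)
  | S k =>
      let '(p0, p1, p2) := prod_jet c a b k in
      (p0 * (1 + c k), p1 * (1 + c k) + p0 * a k,
       p2 * (1 + c k) + p1 * a k + p0 * b k)
  end.

(** One majorant bounds the coefficients and the remainder constant, so the jet of a factor has size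
    at most [1 + 4 * d n]; this is the 4 in the exponential bounds below. *)
Definition summable_jets (f : nat -> C -> C) (z0 : C) (c a b : nat -> C)
    (d : nat -> R) : Prop :=
  ex_series d /\ forall n,
    Cmod (c n) <= d n /\ Cmod (a n) <= d n /\ Cmod (b n) <= d n /\
    jet (f n) z0 1 (1 + c n) (a n) (b n) (d n).

Lemma sum_n_le_Series (d : nat -> R) (n : nat) :
  (forall k, 0 <= d k) -> ex_series d -> sum_n d n <= Series d.
Proof.
  intros Hd0 Hd. rewrite sum_n_Reals. apply sum_incr; [|exact Hd0].
  apply Series_correct, is_series_Reals in Hd. exact Hd.
Qed.

(** Sizes of jets are submultiplicative and [1 + 4 * d k <= exp (4 * d k)], so the bound does not
    depend on [n]. *)
Lemma partial_prod_jet (f : nat -> C -> C) (z0 : C) (c a b : nat -> C)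
    (d : nat -> R) (n : nat) :
  summable_jets f z0 c a b d ->
  let '(p0, p1, p2) := prod_jet c a b n in
  exists M : R, 0 <= M /\
    jet (fun z => C_partial_prod (fun k => f k z) n) z0 1 p0 p1 p2 M /\
    Cmod p0 + Cmod p1 + Cmod p2 + M <= exp (4 * Series d).
Proof.
  intros (Hd & Hall).
  assert (d_ge_0 : forall k, 0 <= d k).
  { intros k. eapply Rle_trans; [apply Cmod_ge_0|apply Hall]. }
  (* The [n]-th partial product stops before index [n], whereas [sum_n d n] includes it; subtracting
     [4 * d n] gives the sum that the induction can carry. *)
  enough (Hn : let '(p0, p1, p2) := prod_jet c a b n in
    exists M : R, 0 <= M /\
      jet (fun z => C_partial_prod (fun k => f k z) n) z0 1 p0 p1 p2 M /\
      Cmod p0 + Cmod p1 + Cmod p2 + M <= exp (4 * sum_n d n - 4 * d n)).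
  { destruct (prod_jet c a b n) as [[p0 p1] p2].
    destruct Hn as (M & H1 & H2 & H3). exists M. split; [exact H1|split; [exact H2|]].
    eapply Rle_trans; [exact H3|].
    assert (Hle : sum_n d n <= Series d).
    { apply sum_n_le_Series; assumption. }
    generalize (d_ge_0 n). intros.
    destruct (Req_dec (4 * sum_n d n - 4 * d n) (4 * Series d)) as [->|]; [lra|].
    left. apply exp_increasing. lra. }
  induction n as [|n IH].
  - simpl. exists 0%R. split; [lra|split].
    + apply jet_poly. intros t. ring.
    + rewrite Cmod_1, !Cmod_0, sum_O. right.
      replace (4 * d 0%nat - 4 * d 0%nat)%R with 0%R by ring. rewrite exp_0. ring.
  - simpl. destruct (prod_jet c a b n) as [[p0 p1] p2].
    destruct (Hall n) as (Hc & Ha & Hb & Hf).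
    destruct IH as (M & HM & HJ & HS).
    eexists. split; [|split].
    2: { apply (jet_mult _ (f n) z0 p0 p1 p2 (1 + c n) (a n) (b n) 1 M (d n));
         [lra|exact HM|apply d_ge_0|exact HJ|exact Hf]. }
    + repeat apply Rplus_le_le_0_compat; apply Rmult_le_pos;
        repeat apply Rplus_le_le_0_compat; auto using Cmod_ge_0.
    + assert (Hc1 : Cmod (1 + c n) <= 1 + d n).
      { apply Cmod_plus_le; [rewrite Cmod_1; lra|exact Hc]. }
      rewrite sum_Sn. change plus with Rplus.
      replace (4 * (sum_n d n + d (S n)) - 4 * d (S n))%R
        with ((4 * sum_n d n - 4 * d n) + 4 * d n)%R by ring.
      rewrite exp_plus.
      apply Rle_trans with
        ((Cmod p0 + Cmod p1 + Cmod p2 + M) * (1 + 4 * d n))%R.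
      * assert (H0 := Cmod_ge_0 p0). assert (H1 := Cmod_ge_0 p1).
        assert (H2 := Cmod_ge_0 p2). assert (Hd0 := d_ge_0 n).
        assert (Q0 := Cmod_ge_0 (1 + c n)).
        assert (Q1 := Cmod_ge_0 (a n)). assert (Q2 := Cmod_ge_0 (b n)).
        assert (K0 : Cmod (p0 * (1 + c n)) <= Cmod p0 * (1 + d n))
          by (apply Cmod_mult_le; [lra|exact Hc1]).
        assert (K1 : Cmod (p1 * (1 + c n) + p0 * a n)
                     <= Cmod p1 * (1 + d n) + Cmod p0 * d n).
        { apply Cmod_plus_le; apply Cmod_mult_le; auto; lra. }
        assert (K2 : Cmod (p2 * (1 + c n) + p1 * a n + p0 * b n)
                     <= Cmod p2 * (1 + d n) + Cmod p1 * d n + Cmod p0 * d n).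
        { repeat apply Cmod_plus_le; apply Cmod_mult_le; auto; lra. }
        assert (K3 : M * (Cmod (1 + c n) + Cmod (a n) + Cmod (b n) + d n)
                     <= M * (1 + 4 * d n)) by (apply Rmult_le_compat_l; lra).
        assert (K4 : Cmod p2 * Cmod (a n) <= Cmod p2 * d n)
          by (apply Rmult_le_compat_l; lra).
        assert (K5 : Cmod p1 * Cmod (b n) <= Cmod p1 * d n)
          by (apply Rmult_le_compat_l; lra).
        assert (K6 : Cmod p2 * Cmod (b n) <= Cmod p2 * d n)
          by (apply Rmult_le_compat_l; lra).
        nra.
      * apply Rmult_le_compat; [| |exact HS|apply exp_ineq1_le].
        -- generalize (Cmod_ge_0 p0) (Cmod_ge_0 p1) (Cmod_ge_0 p2). lra.
        -- generalize (d_ge_0 n). lra.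
Qed.

(** A step adds one, two or three products of an old coefficient, bounded by [E], with one of [c n],
    [a n], [b n]; hence the majorants with constants 1, 2 and 3. *)
Lemma prod_jet_Clim (f : nat -> C -> C) (z0 : C) (c a b : nat -> C) (d : nat -> R) :
  summable_jets f z0 c a b d ->
  exists l0 l1 l2 : C,
    Clim (fun n => fst (fst (prod_jet c a b n))) l0 /\
    Clim (fun n => snd (fst (prod_jet c a b n))) l1 /\
    Clim (fun n => snd (prod_jet c a b n)) l2.
Proof.
  intros HJ. assert (Hd := proj1 HJ). assert (Hall := proj2 HJ).
  set (E := exp (4 * Series d)).
  assert (HE : forall k : R, ex_series (fun n => k * E * d n)%R).
  { intros k. apply (ex_series_scal (V := R_NormedModule) (k * E)%R d), Hd. }
  destruct (Clim_of_summable_increments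
              (fun n => fst (fst (prod_jet c a b n))) (fun n => 1 * E * d n)%R)
    as [l0 H0]; [|apply HE|].
  2: destruct (Clim_of_summable_increments
              (fun n => snd (fst (prod_jet c a b n))) (fun n => 2 * E * d n)%R)
    as [l1 H1]; [|apply HE|].
  3: destruct (Clim_of_summable_increments
              (fun n => snd (prod_jet c a b n)) (fun n => 3 * E * d n)%R)
    as [l2 H2]; [|apply HE|exists l0, l1, l2; auto].
  all: intros n; generalize (partial_prod_jet f z0 c a b d n HJ); simpl;
    destruct (Hall n) as (Hc & Ha & Hb & _);
    destruct (prod_jet c a b n) as [[p0 p1] p2]; simpl;
    intros (M & HM & _ & HS); fold E in HS;
    assert (P0 := Cmod_ge_0 p0); assert (P1 := Cmod_ge_0 p1);
    assert (P2 := Cmod_ge_0 p2);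
    assert (Hd0 : 0 <= d n) by (generalize (Cmod_ge_0 (c n)); lra).
  - replace (p0 * (1 + c n) - p0) with (p0 * c n) by ring.
    eapply Rle_trans; [apply Cmod_mult_le; [apply Rle_refl|apply Hc]|].
    apply Rmult_le_compat_r; lra.
  - replace (p1 * (1 + c n) + p0 * a n - p1) with (p1 * c n + p0 * a n) by ring.
    eapply Rle_trans.
    { apply Cmod_plus_le; (apply Cmod_mult_le; [apply Rle_refl|eassumption]). }
    rewrite <- Rmult_plus_distr_r. apply Rmult_le_compat_r; lra.
  - replace (p2 * (1 + c n) + p1 * a n + p0 * b n - p2)
      with (p2 * c n + p1 * a n + p0 * b n) by ring.
    eapply Rle_trans.
    { repeat apply Cmod_plus_le; (apply Cmod_mult_le; [apply Rle_refl|eassumption]). }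
    rewrite <- !Rmult_plus_distr_r. apply Rmult_le_compat_r; lra.
Qed.

(** The coefficients of the partial products converge and their remainder constants are uniformly
    bounded, so the jet inequality passes to the limit for each fixed [t]. *)
Lemma infprod_taylor2 (f : nat -> C -> C) (z0 : C) (c a b : nat -> C) (d : nat -> R)
    (P : C -> C) :
  summable_jets f z0 c a b d ->
  (forall z, is_infprod (fun n => f n z) (P z)) -> taylor2 P z0.
Proof.
  intros HJf HP. destruct (prod_jet_Clim f z0 c a b d HJf) as (l0 & l1 & l2 & H0 & H1 & H2).
  exists 1%R, l0, l1, l2, (exp (4 * Series d)).
  split; [lra|split; [left; apply exp_pos|]].
  intros t Ht.
  apply Clim_Cmod_le with (fun n =>
    C_partial_prod (fun k => f k (z0 + t)) n
    + - 1 * (fst (fst (prod_jet c a b n)) + snd (fst (prod_jet c a b n)) * t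
       + snd (prod_jet c a b n) * (t * t))).
  - intros n. generalize (partial_prod_jet f z0 c a b d n HJf).
    destruct (prod_jet c a b n) as [[p0 p1] p2]. simpl fst. simpl snd.
    intros (M & HM & HJ & HS). specialize (HJ t Ht). simpl in HJ.
    replace (- 1 * (p0 + p1 * t + p2 * (t * t)))
      with (- (p0 + p1 * t + p2 * (t * t))) by ring.
    eapply Rle_trans; [exact HJ|].
    apply Rmult_le_compat_r; [apply (pow_le _ 3), Cmod_ge_0|].
    generalize (Cmod_ge_0 p0) (Cmod_ge_0 p1) (Cmod_ge_0 p2). lra.
  - replace (P (z0 + t) - (l0 + l1 * t + l2 * (t * t)))
      with (P (z0 + t) + - 1 * (l0 + l1 * t + l2 * (t * t))) by ring.
    apply Clim_plus; [apply HP|].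
    apply Clim_mult; [apply Clim_const|].
    apply Clim_plus; [apply Clim_plus; [exact H0|]|];
      apply Clim_mult; auto using Clim_const.
Qed.

(** The numbers [u n] are taken as constant functions: the zeroth jet coefficients are then the
    partial products, whose convergence is known. *)
Lemma ex_is_infprod (u : nat -> C) (d : nat -> R) :
  (forall n, Cmod (u n - 1) <= d n) -> ex_series d -> exists l, is_infprod u l.
Proof.
  intros Hu Hd.
  assert (Hd0 : forall n, 0 <= d n).
  { intros n. eapply Rle_trans; [apply Cmod_ge_0|apply Hu]. }
  destruct (prod_jet_Clim (fun n _ => u n) 0 (fun n => u n - 1) (fun _ => 0)
              (fun _ => 0) d) as (l & _ & _ & H & _).
  - split; [exact Hd|]. intros n. rewrite Cmod_0. repeat split; auto.
    eapply jet_weaken; [apply Rle_refl|apply Hd0|].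
    apply jet_poly. intros t. ring.
  - exists l. revert H. apply Clim_ext. intros n. induction n as [|n IH]; [reflexivity|].
    simpl. rewrite <- IH. destruct (prod_jet _ _ _ n) as [[p0 p1] p2]. simpl. ring.
Qed.

(** * The exponential function *)

(** The mean value theorem gains one power of [x] per integration; three applications bound a
    second-order Taylor remainder by the third derivative. *)
Lemma Rabs_le_pow_S_of_derive (f g : R -> R) (K r : R) (n : nat) :
  0 <= K ->
  (forall x, is_derive f x (g x)) -> f 0%R = 0%R ->
  (forall x, Rabs x <= r -> Rabs (g x) <= K * Rabs x ^ n) ->
  forall x, Rabs x <= r -> Rabs (f x) <= K * Rabs x ^ S n.
Proof.
  intros HK Hd H0 Hg x Hx.
  destruct (MVT_gen f 0 x g) as (xi & Hxi & E).
  - intros y _. apply Hd.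
  - intros y _. apply derivable_continuous_pt. exists (g y). apply is_derive_Reals, Hd.
  - assert (Hxi' : Rabs xi <= Rabs x).
    { revert Hxi. unfold Rmin, Rmax, Rabs.
      destruct Rle_dec; destruct (Rcase_abs xi); destruct (Rcase_abs x); lra. }
    rewrite H0, !Rminus_0_r in E. rewrite E, Rabs_mult. simpl.
    replace (K * (Rabs x * Rabs x ^ n))%R with (K * Rabs x ^ n * Rabs x)%R by ring.
    apply Rmult_le_compat_r; [apply Rabs_pos|].
    eapply Rle_trans; [apply Hg; lra|].
    apply Rmult_le_compat_l; [exact HK|]. apply pow_incr. split; [apply Rabs_pos|exact Hxi'].
Qed.

Lemma exp_taylor2 (r x : R) :
  Rabs x <= r -> Rabs (exp x - (1 + x + x * x / 2)) <= exp r * Rabs x ^ 3.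
Proof.
  assert (HK : 0 <= exp r) by (left; apply exp_pos).
  apply (Rabs_le_pow_S_of_derive (fun y => exp y - (1 + y + y * y / 2))%R
           (fun y => exp y - (1 + y))%R); [exact HK| | |].
  { intros y. auto_derive; [exact I|field]. }
  { rewrite exp_0. field. }
  apply (Rabs_le_pow_S_of_derive (fun y => exp y - (1 + y))%R
           (fun y => exp y - 1)%R); [exact HK| | |].
  { intros y. auto_derive; [exact I|ring]. }
  { rewrite exp_0. ring. }
  apply (Rabs_le_pow_S_of_derive (fun y => exp y - 1)%R exp); [exact HK| | |].
  { intros y. auto_derive; [exact I|ring]. }
  { rewrite exp_0. ring. }
  intros y Hy. rewrite pow_O, Rmult_1_r, Rabs_pos_eq by (left; apply exp_pos).
  apply Rabs_le_between in Hy. destruct (Rle_lt_or_eq_dec y r (proj2 Hy)) as [H| ->]; [|lra].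
  left. apply exp_increasing, H.
Qed.

Lemma sin_taylor2 (y : R) : Rabs (sin y - y) <= Rabs y ^ 3.
Proof.
  rewrite <- (Rmult_1_l (Rabs y ^ 3)).
  apply (Rabs_le_pow_S_of_derive (fun y => sin y - y)%R
           (fun y => cos y - 1)%R 1 (Rabs y)); [lra| | | |lra].
  { intros x. auto_derive; [exact I|ring]. }
  { rewrite sin_0. ring. }
  apply (Rabs_le_pow_S_of_derive (fun y => cos y - 1)%R (fun y => - sin y)%R 1); [lra| | |].
  { intros x. auto_derive; [exact I|ring]. }
  { rewrite cos_0. ring. }
  apply (Rabs_le_pow_S_of_derive (fun y => - sin y)%R (fun y => - cos y)%R 1); [lra| | |].
  { intros x. auto_derive; [exact I|ring]. }
  { rewrite sin_0. ring. }
  intros x _. rewrite Rabs_Ropp, pow_O. apply Rabs_le.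
  generalize (COS_bound x). lra.
Qed.

Lemma cos_taylor2 (y : R) : Rabs (cos y - (1 - y * y / 2)) <= Rabs y ^ 3.
Proof.
  rewrite <- (Rmult_1_l (Rabs y ^ 3)).
  apply (Rabs_le_pow_S_of_derive (fun y => cos y - (1 - y * y / 2))%R
           (fun y => y - sin y)%R 1 (Rabs y)); [lra| | | |lra].
  { intros x. auto_derive; [exact I|field]. }
  { rewrite cos_0. field. }
  apply (Rabs_le_pow_S_of_derive (fun y => y - sin y)%R (fun y => 1 - cos y)%R 1); [lra| | |].
  { intros x. auto_derive; [exact I|ring]. }
  { rewrite sin_0. ring. }
  apply (Rabs_le_pow_S_of_derive (fun y => 1 - cos y)%R sin 1); [lra| | |].
  { intros x. auto_derive; [exact I|ring]. }
  { rewrite cos_0. ring. }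
  intros x _. rewrite pow_O. apply Rabs_le. generalize (SIN_bound x). lra.
Qed.

Lemma C_Re_Im (z : C) : z = RtoC (Re z) + Ci * RtoC (Im z).
Proof. destruct z as [x y]. apply injective_projections; simpl; ring. Qed.

Lemma Ci_sqr : Ci * Ci = - (1).
Proof. apply injective_projections; simpl; ring. Qed.

Lemma Cexp_0 : Cexp 0 = 1.
Proof.
  unfold Cexp. simpl. rewrite exp_0, cos_0, sin_0.
  apply injective_projections; simpl; ring.
Qed.

Lemma Cexp_plus (a b : C) : Cexp (a + b) = Cexp a * Cexp b.
Proof.
  unfold Cexp. destruct a as [a1 a2], b as [b1 b2]. simpl.
  rewrite exp_plus, cos_plus, sin_plus.
  apply injective_projections; simpl; ring.
Qed.

Lemma Cexp_neq_0 (z : C) : Cexp z <> 0.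
Proof.
  intros E. assert (H : Cexp (z + - z) = 1).
  { replace (z + - z) with (RtoC 0) by ring. apply Cexp_0. }
  rewrite Cexp_plus, E in H. apply (f_equal Cmod) in H.
  rewrite Cmult_0_l, Cmod_0, Cmod_1 in H. lra.
Qed.

Lemma Cexp_RtoC (x : R) : Cexp (RtoC x) = RtoC (exp x).
Proof.
  unfold Cexp. simpl. rewrite cos_0, sin_0.
  apply injective_projections; simpl; ring.
Qed.

Lemma Cexp_taylor2 (r : R) :
  exists K : R, 0 <= K /\ forall z, Cmod z <= r ->
    Cmod (Cexp z - (1 + z + z * z / 2)) <= K * Cmod z ^ 3.
Proof.
  destruct (Rlt_le_dec r 0) as [Hr|Hr].
  { exists 0%R. split; [lra|]. intros z Hz. generalize (Cmod_ge_0 z). lra. }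
  (* One summand per source of error: the remainder of [exp x] against the unimodular cos y + i sin
     y, the remainders of [cos] and [sin] against the polynomial in [x], and the mixed terms of
     order 3 and 4 left when the two expansions are multiplied. *)
  exists (exp r * 1 + (1 + r + r * r) * 2 + (1 + r))%R.
  assert (He := exp_pos r). split; [nra|].
  intros z Hz. set (x := Re z). set (y := Im z).
  assert (Hx : Rabs x <= Cmod z) by apply re_le_Cmod.
  assert (Hy : Rabs y <= Cmod z).
  { eapply Rle_trans; [apply Rmax_r|apply (Rmax_Cmod z)]. }
  set (rx := (exp x - (1 + x + x * x / 2))%R).
  set (ry := RtoC (cos y - (1 - y * y / 2)) + Ci * RtoC (sin y - y)).
  assert (Hrx : Rabs rx <= exp r * Cmod z ^ 3).
  { eapply Rle_trans; [apply (exp_taylor2 r); lra|].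
    apply Rmult_le_compat_l; [lra|]. apply pow_incr. split; [apply Rabs_pos|exact Hx]. }
  assert (Hy3 : Rabs y ^ 3 <= Cmod z ^ 3).
  { apply pow_incr. split; [apply Rabs_pos|exact Hy]. }
  assert (Hry : Cmod ry <= 2 * Cmod z ^ 3).
  { unfold ry. replace (2 * Cmod z ^ 3)%R with (Cmod z ^ 3 + 1 * Cmod z ^ 3)%R by ring.
    apply Cmod_plus_le; [|apply Cmod_mult_le; [rewrite Cmod_Ci; lra|]]; rewrite Cmod_R.
    - generalize (cos_taylor2 y). lra.
    - generalize (sin_taylor2 y). lra. }
  set (X := RtoC x). set (Y := RtoC y).
  assert (Hz' : z = X + Ci * Y) by apply C_Re_Im.
  assert (Hcs : Cmod (RtoC (cos y) + Ci * RtoC (sin y)) <= 1).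
  { right. transitivity (sqrt 1); [|apply sqrt_1]. unfold Cmod. f_equal. simpl.
    transitivity (Rsqr (sin y) + Rsqr (cos y))%R; [unfold Rsqr; ring|apply sin2_cos2]. }
  assert (EC : RtoC (cos y) = RtoC (cos y - (1 - y * y / 2)) + (1 - Y * Y / 2)).
  { unfold Y. rewrite <- RtoC_mult, <- RtoC_div, <- RtoC_minus, <- RtoC_plus by lra.
    f_equal. ring. }
  assert (ES : RtoC (sin y) = RtoC (sin y - y) + Y).
  { unfold Y. rewrite <- RtoC_plus. f_equal. ring. }
  assert (EX : RtoC (exp x) = RtoC rx + (1 + X + X * X / 2)).
  { unfold X, rx. rewrite <- RtoC_mult, <- RtoC_div, <- !RtoC_plus by lra.
    f_equal. ring. }
  assert (E : Cexp z - (1 + z + z * z / 2)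
    = RtoC rx * (RtoC (cos y) + Ci * RtoC (sin y))
      + (1 + X + X * X / 2) * ry
      + X * Y * (Ci * (X / 2) - Y / 2 - X * Y / 4)).
  { replace (Cexp z) with (RtoC (exp x) * (RtoC (cos y) + Ci * RtoC (sin y))).
    2: { unfold Cexp. fold x y. f_equal. apply injective_projections; simpl; ring. }
    rewrite EX. rewrite Hz' at 1 2 3.
    transitivity (RtoC rx * (RtoC (cos y) + Ci * RtoC (sin y))
      + (1 + X + X * X / 2) * (RtoC (cos y) + Ci * RtoC (sin y))
      - (1 + (X + Ci * Y) + (X * X + 2 * Ci * X * Y + (Ci * Ci) * (Y * Y)) / 2)).
    { field. }
    rewrite Ci_sqr. rewrite EC at 2. rewrite ES at 2. unfold ry. field. }
  rewrite E.
  assert (HX : Cmod X <= Cmod z) by (unfold X; rewrite Cmod_R; exact Hx).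
  assert (HY : Cmod Y <= Cmod z) by (unfold Y; rewrite Cmod_R; exact Hy).
  assert (Hz0 := Cmod_ge_0 z).
  assert (H2 : Cmod (/ 2) = (/ 2)%R).
  { rewrite <- RtoC_inv, Cmod_R by lra. apply Rabs_pos_eq. lra. }
  assert (H4 : Cmod (/ 4) = (/ 4)%R).
  { rewrite <- RtoC_inv, Cmod_R by lra. apply Rabs_pos_eq. lra. }
  assert (HA : Cmod (1 + X + X * X / 2) <= 1 + r + r * r).
  { unfold Cdiv. repeat apply Cmod_plus_le; [rewrite Cmod_1; lra|lra|].
    rewrite !Cmod_mult, H2. assert (P := Cmod_ge_0 X). nra. }
  assert (HB : Cmod (Ci * (X / 2) - Y / 2 - X * Y / 4) <= (1 + r) * Cmod z).
  { unfold Cdiv, Cminus.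
    eapply Rle_trans.
    { repeat apply Cmod_plus_le; [| |]; [|rewrite Cmod_opp|rewrite Cmod_opp];
        rewrite !Cmod_mult; [rewrite Cmod_Ci|..]; apply Rle_refl. }
    rewrite H2, H4. assert (P := Cmod_ge_0 X). assert (Q := Cmod_ge_0 Y).
    assert (Cmod X * Cmod Y <= r * Cmod z) by (apply Rmult_le_compat; lra).
    assert (0 <= r * Cmod z) by (apply Rmult_le_pos; lra).
    lra. }
  assert (HXY : Cmod (X * Y) <= Cmod z * Cmod z) by (apply Cmod_mult_le; assumption).
  eapply Rle_trans.
  { apply Cmod_plus_le; [apply Cmod_plus_le|]; apply Cmod_mult_le; try eassumption.
    rewrite Cmod_R. exact Hrx. }
  right. simpl. ring.
Qed.

(** One [K] serves all [m] with [Cmod m <= r], and the remainder keeps the factor [Cmod m ^ 3]: both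
    serve to sum over the Gamma factors, where [m] tends to 0. *)
Lemma Cexp_linear_jet (m z0 : C) (K r : R) :
  (forall z, Cmod z <= r -> Cmod (Cexp z - (1 + z + z * z / 2)) <= K * Cmod z ^ 3) ->
  Cmod m <= r ->
  jet (fun z => Cexp (m * z)) z0 1 (Cexp (m * z0)) (Cexp (m * z0) * m)
    (Cexp (m * z0) * (m * m / 2)) (Cmod (Cexp (m * z0)) * (K * Cmod m ^ 3)).
Proof.
  intros HK Hm t Ht.
  replace (m * (z0 + t)) with (m * z0 + m * t) by ring. rewrite Cexp_plus.
  replace (Cexp (m * z0) * Cexp (m * t) - (Cexp (m * z0) + Cexp (m * z0) * m * t
            + Cexp (m * z0) * (m * m / 2) * (t * t)))
    with (Cexp (m * z0) * (Cexp (m * t) - (1 + m * t + m * t * (m * t) / 2)))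
    by field.
  rewrite Cmod_mult, Rmult_assoc.
  apply Rmult_le_compat_l; [apply Cmod_ge_0|].
  replace (K * Cmod m ^ 3 * Cmod t ^ 3)%R with (K * Cmod (m * t) ^ 3)%R
    by (rewrite Cmod_mult; ring).
  apply HK. rewrite Cmod_mult.
  generalize (Cmod_ge_0 m) (Cmod_ge_0 t). nra.
Qed.

Lemma taylor2_Cexp_linear (m z0 : C) : taylor2 (fun z => Cexp (m * z)) z0.
Proof.
  destruct (Cexp_taylor2 (Cmod m)) as (K & HK & H).
  do 5 eexists. split; [|split; [|apply (Cexp_linear_jet m z0 K (Cmod m) H), Rle_refl]].
  - lra.
  - apply Rmult_le_pos; [apply Cmod_ge_0|].
    apply Rmult_le_pos; [exact HK|apply pow_le, Cmod_ge_0].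
Qed.

Lemma Rpow_C_mult_base (x y : R) (s : C) :
  0 < x -> 0 < y -> Rpow_C (x * y) s = Rpow_C x s * Rpow_C y s.
Proof.
  intros Hx Hy. unfold Rpow_C. rewrite ln_mult, RtoC_plus by assumption.
  rewrite <- Cexp_plus. f_equal. ring.
Qed.

Lemma Rpow_C_plus (x : R) (s t : C) : Rpow_C x (s + t) = Rpow_C x s * Rpow_C x t.
Proof. unfold Rpow_C. rewrite <- Cexp_plus. f_equal. ring. Qed.

Lemma Rpow_C_neq_0 (x : R) (s : C) : Rpow_C x s <> 0.
Proof. apply Cexp_neq_0. Qed.

Lemma Rpow_C_half (x : R) : 0 < x -> Rpow_C x (1 / 2) = RtoC (sqrt x).
Proof.
  intros Hx. unfold Rpow_C.
  rewrite <- RtoC_div, <- RtoC_mult, Cexp_RtoC by lra. f_equal.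
  rewrite <- Rpower_sqrt by exact Hx. unfold Rpower. f_equal. field.
Qed.

(** * The reciprocal of the Gamma function *)

Lemma Cinv_0 : / (0 : C) = 0.
Proof. apply injective_projections; simpl; unfold Rdiv; ring. Qed.

(** Unconditional because [/ 0 = 0], so reciprocals can be multiplied at the poles of Gamma as
    well. *)
Lemma Cinv_mult (a b : C) : / (a * b) = / a * / b.
Proof.
  destruct (Ceq_or_neq a 0) as [->|Ha]; [rewrite Cmult_0_l, Cinv_0; ring|].
  destruct (Ceq_or_neq b 0) as [->|Hb]; [rewrite Cmult_0_r, Cinv_0; ring|].
  field. auto.
Qed.

Lemma is_lim_seq_inv_INR_S : is_lim_seq (fun n => / INR (S n))%R 0%R.
Proof.
  apply (is_lim_seq_incr_1 (fun n => / INR n)%R).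
  evar_last; [apply (is_lim_seq_inv _ p_infty); [apply is_lim_seq_INR|discriminate]|].
  reflexivity.
Qed.

(** Comparison with a telescoping series: 1/n^2 <= 2/(n (n + 1)) = 2 (1/n - 1/(n + 1)). *)
Lemma ex_series_inv_S_sqr : ex_series (fun n : nat => / INR (S n) * / INR (S n))%R.
Proof.
  assert (Hpos : forall n, 0 < INR (S n)) by (intros n; apply lt_0_INR; lia).
  apply (ex_series_le (V := R_CompleteNormedModule) _
           (fun n => 2 * (/ INR (S n) - / INR (S (S n))))%R).
  - intros n. change norm with Rabs.
    assert (H := Hpos n).
    assert (H1 : 1 <= INR (S n)) by (rewrite S_INR; generalize (pos_INR n); lra).
    rewrite (S_INR (S n)). set (x := INR (S n)) in *.
    rewrite Rabs_pos_eq.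
    + replace (2 * (/ x - / (x + 1)))%R with (/ x * (2 / (x + 1)))%R by (field; lra).
      apply Rmult_le_compat_l; [left; apply Rinv_0_lt_compat, H|].
      replace (/ x)%R with ((x + 1) / x * / (x + 1))%R by (field; lra).
      apply Rmult_le_compat_r; [left; apply Rinv_0_lt_compat; lra|].
      apply Rmult_le_reg_r with x; [exact H|].
      replace ((x + 1) / x * x)%R with (x + 1)%R by (field; lra). lra.
    + apply Rmult_le_pos; left; apply Rinv_0_lt_compat, H.
  - apply (ex_series_scal (V := R_NormedModule) 2%R). exists 1%R.
    change (is_lim_seq (sum_n (fun n => / INR (S n) - / INR (S (S n)))%R) 1%R).
    apply (is_lim_seq_ext (fun n => 1 - / INR (S (S n)))%R).
    + intros n. induction n as [|n IH].
      * rewrite sum_O. simpl. lra.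
      * rewrite sum_Sn, <- IH. change plus with Rplus. ring.
    + evar_last.
      * apply is_lim_seq_minus'; [apply is_lim_seq_const|].
        apply (is_lim_seq_incr_1 (fun n => / INR (S n))%R), is_lim_seq_inv_INR_S.
      * simpl. apply f_equal. ring.
Qed.

(* The factor [(1 + s/k) (1 - 1/k)^s] with [k = j + 2]; the product of the first
   [N] of them is [(1 + s/2) ... (1 + s/(N+1)) (N+1)^(-s)]. *)
Definition gamma_factor (j : nat) (s : C) : C :=
  (1 + s / RtoC (INR (S (S j)))) * Rpow_C (INR (S j) / INR (S (S j))) s.

(** Both bounds are [ln u <= u - 1], at the ratio and at its inverse. They place -ln(1 - 1/k), for k
    = j + 2, between 1/k and 1/(k - 1), hence within O(1/k^2) of 1/k. *)
Lemma ln_ratio_bounds (j : nat) :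
  / INR (S (S j)) <= - ln (INR (S j) / INR (S (S j))) <= / INR (S j).
Proof.
  assert (H : 0 < INR (S j)) by (apply lt_0_INR; lia).
  rewrite (S_INR (S j)). set (x := INR (S j)) in *.
  assert (Hl : forall u, 0 < u -> ln u <= u - 1).
  { intros u Hu. generalize (exp_ineq1_le (ln u)). rewrite exp_ln by exact Hu. lra. }
  assert (Hq : 0 < x / (x + 1)) by (apply Rdiv_lt_0_compat; lra).
  split.
  - assert (E := Hl _ Hq).
    replace (x / (x + 1) - 1)%R with (- / (x + 1))%R in E by (field; lra). lra.
  - rewrite <- ln_Rinv by exact Hq.
    replace (/ (x / (x + 1)))%R with ((x + 1) / x)%R by (field; lra).
    eapply Rle_trans; [apply Hl, Rdiv_lt_0_compat; lra|].
    right. field. lra.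
Qed.

(** With x = 1/k, m = ln(1 - 1/k) and k = j + 2 the factor is (1 + x s) exp(m s). Separately x and m
    are only of order 1/k, which is not summable, but x + m is of order 1/k^2; the coefficients are
    arranged around that sum and around products such as x m and m^2. *)
Lemma gamma_factor_jets (z0 : C) :
  exists (c a b : nat -> C) (d : nat -> R), summable_jets gamma_factor z0 c a b d.
Proof.
  set (A := Cmod z0). assert (HA : 0 <= A) by apply Cmod_ge_0.
  (* The radius [A + 1] covers both [m j * z0], bounded by [A], and [m j] itself, bounded by 1. *)
  destruct (Cexp_taylor2 (A + 1)) as (K & HK & Hexp).
  set (x := fun j => RtoC (/ INR (S (S j)))).
  set (m := fun j => RtoC (ln (INR (S j) / INR (S (S j))))).
  set (e := fun j => Cexp (m j * z0)).
  (* [K1] bounds the distance from [e j] to [1 + m j * z0] in units of [A * A * (y * y)], where [y]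
     is 1/(j + 1), and [K0] bounds [e j] itself. *)
  set (K1 := (K * (A + 1) + 1)%R). set (K0 := (1 + A + K1 * (A * A))%R).
  assert (HK1 : 1 <= K1) by (unfold K1; nra).
  assert (HK0 : 1 <= K0) by (unfold K0; nra).
  (* In units of [y * y]: the bound for the zeroth coefficient, those for the first and second, and
     that for the remainder constant. *)
  set (D := (K1 * (A * A) * (1 + A) + A + A * A
             + K0 * (1 + A) + K0 * (1 + A + 1)
             + (K0 + (1 + A + 1) * (K0 * K)))%R).
  exists (fun j => e j * (1 + x j * z0) - 1),
    (fun j => e j * (x j + m j + m j * (x j * z0))),
    (fun j => e j * (m j * m j / 2 * (1 + x j * z0) + x j * m j)),
    (fun j => D * (/ INR (S j) * / INR (S j)))%R.
  split; [apply (ex_series_scal (V := R_NormedModule) D), ex_series_inv_S_sqr|].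
  intros j.
  assert (Hb := ln_ratio_bounds j).
  assert (Hj : 1 <= INR (S j)) by (rewrite S_INR; generalize (pos_INR j); lra).
  set (y := (/ INR (S j))%R) in *.
  assert (Hy : 0 < y <= 1).
  { unfold y. split; [apply Rinv_0_lt_compat; lra|].
    rewrite <- Rinv_1. apply Rinv_le_contravar; lra. }
  assert (Hx0 : 0 < / INR (S (S j)) <= y).
  { split; [apply Rinv_0_lt_compat, lt_0_INR; lia|].
    apply Rinv_le_contravar; [lra|]. rewrite (S_INR (S j)). lra. }
  assert (Hxy : y - / INR (S (S j)) <= y * y).
  { unfold y. rewrite (S_INR (S j)). set (X := INR (S j)) in *.
    replace (/ X - / (X + 1))%R with (/ X * / (X + 1))%R by (field; lra).
    apply Rmult_le_compat_l; [left; apply Rinv_0_lt_compat; lra|].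
    apply Rinv_le_contravar; lra. }
  assert (Hx : Cmod (x j) <= y).
  { unfold x. rewrite Cmod_R. apply Rabs_le. lra. }
  assert (Hm : Cmod (m j) <= y).
  { unfold m. rewrite Cmod_R. apply Rabs_le. lra. }
  assert (Hxm : Cmod (x j + m j) <= y * y).
  { unfold x, m. rewrite <- RtoC_plus, Cmod_R. apply Rabs_le. nra. }
  assert (Hjx : 1 + z0 / RtoC (INR (S (S j))) = 1 + x j * z0).
  { unfold x. rewrite RtoC_inv by (apply not_0_INR; lia). unfold Cdiv. ring. }
  assert (Hmz : Cmod (m j * z0) <= y * A) by (apply Cmod_mult_le; [exact Hm|apply Rle_refl]).
  assert (Hxz : Cmod (x j * z0) <= y * A) by (apply Cmod_mult_le; [exact Hx|apply Rle_refl]).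
  assert (HyA : y * A <= A) by nra.
  assert (H1xz : Cmod (1 + x j * z0) <= 1 + A).
  { apply Cmod_plus_le; [rewrite Cmod_1; lra|lra]. }
  assert (H2 : Cmod (/ 2) = (/ 2)%R).
  { rewrite <- RtoC_inv, Cmod_R by lra. apply Rabs_pos_eq. lra. }
  assert (Hs : Cmod (e j - (1 + m j * z0)) <= K1 * (A * A) * (y * y)).
  { replace (e j - (1 + m j * z0)) with
      ((e j - (1 + m j * z0 + m j * z0 * (m j * z0) / 2)) + m j * z0 * (m j * z0) / 2)
      by ring.
    eapply Rle_trans.
    { apply Cmod_plus_le; [apply Hexp; lra|]. unfold Cdiv.
      rewrite Cmod_mult, H2. rewrite Cmod_mult. apply Rle_refl. }
    set (w := Cmod (m j * z0)) in *.
    assert (Hw : 0 <= w) by apply Cmod_ge_0.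
    assert (Hw2 : w * w <= y * A * (y * A)) by (apply Rmult_le_compat; lra).
    apply Rle_trans with (K1 * (w * w))%R.
    - unfold K1. replace (K * w ^ 3)%R with (K * w * (w * w))%R by ring.
      assert (K * w <= K * (A + 1)) by (apply Rmult_le_compat_l; lra).
      assert (0 <= w * w) by nra. nra.
    - replace (K1 * (A * A) * (y * y))%R with (K1 * (y * A * (y * A)))%R by ring.
      apply Rmult_le_compat_l; lra. }
  assert (He : Cmod (e j) <= K0).
  { replace (e j) with (1 + m j * z0 + (e j - (1 + m j * z0))) by ring.
    unfold K0. repeat apply Cmod_plus_le; [rewrite Cmod_1; lra|lra|].
    eapply Rle_trans; [exact Hs|].
    rewrite <- (Rmult_1_r (K1 * (A * A))) at 2.
    apply Rmult_le_compat_l; [|nra]. nra. }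
  assert (Hyy : 0 < y * y) by nra.
  assert (HAA : 0 <= A * A) by nra.
  assert (HD1 : 0 <= K1 * (A * A) * (1 + A)).
  { apply Rmult_le_pos; [apply Rmult_le_pos|]; lra. }
  assert (HD2 : 0 <= K0 * (1 + A)) by (apply Rmult_le_pos; lra).
  assert (HD3 : 0 <= K0 * (1 + A + 1)) by (apply Rmult_le_pos; lra).
  assert (HD4 : 0 <= (1 + A + 1) * (K0 * K)).
  { apply Rmult_le_pos; [lra|]. apply Rmult_le_pos; lra. }
  assert (HDle : forall u v, v <= u * (y * y) -> u <= D -> v <= D * (y * y)).
  { intros u v Hv Hu. eapply Rle_trans; [exact Hv|]. apply Rmult_le_compat_r; lra. }
  assert (Hm2 : Cmod (m j * m j / 2) <= y * y).
  { unfold Cdiv. rewrite !Cmod_mult, H2. generalize (Cmod_ge_0 (m j)). nra. }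
  split; [|split; [|split]].
  - apply HDle with (K1 * (A * A) * (1 + A) + A + A * A)%R; [|unfold D; lra].
    replace (e j * (1 + x j * z0) - 1) with
      ((e j - (1 + m j * z0)) * (1 + x j * z0) + (x j + m j) * z0
       + m j * z0 * (x j * z0)) by ring.
    eapply Rle_trans.
    { repeat apply Cmod_plus_le; apply Cmod_mult_le;
        [exact Hs|exact H1xz|exact Hxm|apply Rle_refl|exact Hmz|exact Hxz]. }
    fold A. right. ring.
  - apply HDle with (K0 * (1 + A))%R; [|unfold D; lra].
    eapply Rle_trans.
    { apply Cmod_mult_le; [exact He|].
      apply Cmod_plus_le; [exact Hxm|apply Cmod_mult_le; [exact Hm|exact Hxz]]. }
    right. ring.
  - apply HDle with (K0 * (1 + A + 1))%R; [|unfold D; lra].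
    eapply Rle_trans.
    { apply Cmod_mult_le; [exact He|].
      apply Cmod_plus_le; apply Cmod_mult_le; [exact Hm2|exact H1xz|exact Hx|exact Hm]. }
    right. ring.
  - apply (jet_ext (fun z => (1 + x j * z) * Cexp (m j * z))).
    { intros z. unfold gamma_factor, Rpow_C, x, m.
      rewrite RtoC_inv by (apply not_0_INR; lia).
      f_equal; [unfold Cdiv; ring|]. f_equal. ring. }
    assert (J1 : jet (fun z => 1 + x j * z) z0 1 (1 + x j * z0) (x j) 0 0).
    { apply jet_poly. intros t. ring. }
    assert (J2 := Cexp_linear_jet (m j) z0 K (A + 1) Hexp ltac:(lra)).
    fold (e j) in J2.
    set (N := (Cmod (e j) * (K * Cmod (m j) ^ 3))%R) in J2.
    assert (Hm3 : 0 <= Cmod (m j) ^ 3) by apply pow_le, Cmod_ge_0.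
    assert (HKm : 0 <= K * Cmod (m j) ^ 3) by (apply Rmult_le_pos; assumption).
    assert (HN : 0 <= N) by (apply Rmult_le_pos; [apply Cmod_ge_0|exact HKm]).
    assert (J := jet_mult _ _ _ _ _ _ _ _ _ _ _ _ (Rle_refl 1) (Rle_refl 0) HN J1 J2).
    replace (1 + (e j * (1 + x j * z0) - 1)) with ((1 + x j * z0) * e j) by ring.
    replace (e j * (x j + m j + m j * (x j * z0)))
      with (x j * e j + (1 + x j * z0) * (e j * m j)) by ring.
    replace (e j * (m j * m j / 2 * (1 + x j * z0) + x j * m j))
      with (0 * e j + x j * (e j * m j) + (1 + x j * z0) * (e j * (m j * m j / 2))) by ring.
    revert J. apply jet_weaken; [lra|].
    rewrite Cmod_0.
    assert (HNb : N <= K0 * K * (y * y)).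
    { unfold N. rewrite (Rmult_assoc K0).
      apply Rmult_le_compat; [apply Cmod_ge_0|exact HKm|exact He|].
      apply Rmult_le_compat_l; [exact HK|].
      apply Rle_trans with (y ^ 3)%R.
      - apply pow_incr. split; [apply Cmod_ge_0|exact Hm].
      - simpl. nra. }
    apply HDle with (K0 + (1 + A + 1) * (K0 * K))%R; [|unfold D; lra].
    assert (Hxe : Cmod (x j) * Cmod (e j * (m j * m j / 2)) <= 1 * (K0 * (y * y))).
    { apply Rmult_le_compat; try apply Cmod_ge_0; [lra|].
      apply Cmod_mult_le; [exact He|exact Hm2]. }
    assert (Hlast : (Cmod (1 + x j * z0) + Cmod (x j) + 0) * N
                    <= (1 + A + 1) * (K0 * K * (y * y))).
    { apply Rmult_le_compat; [|exact HN| |exact HNb].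
      - generalize (Cmod_ge_0 (1 + x j * z0)) (Cmod_ge_0 (x j)). lra.
      - lra. }
    lra.
Qed.

Lemma summable_jets_center (f : nat -> C -> C) (z0 : C) (c a b : nat -> C) (d : nat -> R) :
  summable_jets f z0 c a b d -> ex_series d /\ forall n, Cmod (f n z0 - 1) <= d n.
Proof.
  intros (Hd & H). split; [exact Hd|]. intros n. destruct (H n) as (Hc & _ & _ & HJ).
  rewrite (jet_center _ _ _ _ _ _ _ Rle_0_1 HJ).
  replace (1 + c n - 1) with (c n) by ring. exact Hc.
Qed.

(** The entire function 1/Gamma. The indices k = 0 and k = 1 are supplied by [s * (1 + s)], because
    (1 - 1/k)^s degenerates at k = 1. *)
Definition rGamma (s : C) : C :=
  s * (1 + s) * infprod (fun j => gamma_factor j s).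

Lemma gamma_factor_infprod (s : C) :
  is_infprod (fun j => gamma_factor j s) (infprod (fun j => gamma_factor j s)).
Proof.
  destruct (gamma_factor_jets s) as (c & a & b & d & H).
  destruct (summable_jets_center _ _ _ _ _ _ H) as (Hd & Hs).
  destruct (ex_is_infprod _ _ Hs Hd) as [l Hl].
  rewrite (is_infprod_unique _ _ Hl). exact Hl.
Qed.

Lemma taylor2_rGamma (z0 : C) : taylor2 rGamma z0.
Proof.
  unfold rGamma. apply taylor2_mult; [apply taylor2_mult|].
  - apply taylor2_ext with (fun z => 1 * z + 0); [intros; ring|apply taylor2_affine].
  - apply taylor2_ext with (fun z => 1 * z + 1); [intros; ring|apply taylor2_affine].
  - destruct (gamma_factor_jets z0) as (c & a & b & d & H).
    apply (infprod_taylor2 _ _ _ _ _ _ _ H). apply gamma_factor_infprod.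
Qed.

Lemma gamma_factor_eq_0 (j : nat) (s : C) :
  gamma_factor j s = 0 <-> s = - RtoC (INR (S (S j))).
Proof.
  assert (Hj : RtoC (INR (S (S j))) <> 0).
  { intros E. apply RtoC_inj in E. revert E. apply not_0_INR. lia. }
  unfold gamma_factor. split.
  - intros E. destruct (Ceq_or_neq (1 + s / RtoC (INR (S (S j)))) 0) as [E1|E1].
    + replace s with ((1 + s / RtoC (INR (S (S j)))) * RtoC (INR (S (S j)))
                      - RtoC (INR (S (S j)))) by (field; exact Hj).
      rewrite E1. ring.
    + exfalso. revert E. apply Cmult_neq_0; [exact E1|apply Rpow_C_neq_0].
  - intros ->. replace (1 + _) with (RtoC 0) by (field; exact Hj). ring.
Qed.

Lemma rGamma_eq_0 (s : C) : rGamma s = 0 <-> is_Gamma_pole s.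
Proof.
  unfold rGamma. split.
  - intros E.
    destruct (Ceq_or_neq s 0) as [->|H0].
    { exists 0%nat. simpl. ring. }
    destruct (Ceq_or_neq (1 + s) 0) as [E1|H1].
    { exists 1%nat. simpl. replace s with (1 + s - 1) by ring. rewrite E1. ring. }
    destruct (gamma_factor_jets s) as (c & a & b & d & H).
    destruct (summable_jets_center _ _ _ _ _ _ H) as (Hd & Hs).
    destruct (classic (exists j, gamma_factor j s = 0)) as [[j Hj]|Hno].
    { exists (S (S j)). apply gamma_factor_eq_0, Hj. }
    exfalso. revert E. apply Cmult_neq_0; [apply Cmult_neq_0; assumption|].
    apply (is_infprod_neq_0 _ d _ Hs Hd); [|apply gamma_factor_infprod].
    intros n En. apply Hno. exists n. exact En.
  - intros [k ->]. destruct k as [|[|j]].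
    + simpl. ring.
    + simpl. ring.
    + rewrite (is_infprod_eq_0 _ j _ (proj2 (gamma_factor_eq_0 j _) eq_refl)
                 (gamma_factor_infprod _)). ring.
Qed.

(** With n = N + 1, Euler's quotient is exactly the reciprocal of the partial product for 1/Gamma;
    the last factor is its numerator n! n^s. *)
Lemma gamma_partial_prod (s : C) (N : nat) :
  C_partial_prod (fun k => s + RtoC (INR k)) (S (S N))
  = s * (1 + s) * C_partial_prod (fun j => gamma_factor j s) N
    * (RtoC (INR (fact (S N))) * Rpow_C (INR (S N)) s).
Proof.
  induction N as [|N IH].
  - simpl. unfold Rpow_C. rewrite ln_1. replace (s * RtoC 0) with (RtoC 0) by ring.
    rewrite Cexp_0. ring.
  - change (C_partial_prod (fun k => s + RtoC (INR k)) (S (S (S N))))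
      with (C_partial_prod (fun k => s + RtoC (INR k)) (S (S N))
            * (s + RtoC (INR (S (S N))))).
    rewrite IH.
    change (C_partial_prod (fun j => gamma_factor j s) (S N))
      with (C_partial_prod (fun j => gamma_factor j s) N * gamma_factor N s).
    change (fact (S (S N))) with (S (S N) * fact (S N))%nat.
    rewrite mult_INR, RtoC_mult.
    set (p := C_partial_prod (fun j => gamma_factor j s) N). unfold gamma_factor.
    assert (H1 : 0 < INR (S N)) by (apply lt_0_INR; lia).
    assert (H2 : 0 < INR (S (S N))) by (apply lt_0_INR; lia).
    replace (Rpow_C (INR (S N)) s)
      with (Rpow_C (INR (S N) / INR (S (S N))) s * Rpow_C (INR (S (S N))) s).
    2: { rewrite <- Rpow_C_mult_base; [f_equal; field; lra| |exact H2].
         apply Rdiv_lt_0_compat; assumption. }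
    field. intros E. apply RtoC_inj in E. lra.
Qed.

Lemma gamma_partial_prod_Clim (s : C) :
  Clim (fun N => s * (1 + s) * C_partial_prod (fun j => gamma_factor j s) N) (rGamma s).
Proof. apply Clim_mult; [apply Clim_const|apply gamma_factor_infprod]. Qed.

Lemma Gamma_rGamma (s : C) : Gamma s = / rGamma s.
Proof.
  apply (iota_filterlim_locally (V := C_CompleteNormedModule)).
  match goal with |- filterlim ?u _ (locally ?l) => change (Clim u l) end.
  (* The shift skips n = 0, so that the base of [Rpow_C] is positive. *)
  apply Clim_S.
  apply Clim_ext with
    (fun N => / (s * (1 + s) * C_partial_prod (fun j => gamma_factor j s) N)).
  { intros N. rewrite gamma_partial_prod. unfold Cdiv.
    set (p := s * (1 + s) * _). set (X := RtoC (INR (fact (S N))) * _).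
    assert (HX : X <> 0).
    { apply Cmult_neq_0; [|apply Rpow_C_neq_0]. intros E. apply RtoC_inj in E.
      revert E. apply INR_fact_neq_0. }
    rewrite (Cinv_mult p X). transitivity (/ p * (X * / X)); [|ring].
    rewrite Cinv_r by exact HX. ring. }
  destruct (Ceq_or_neq (rGamma s) 0) as [E|Hne].
  - rewrite E. destruct (proj1 (rGamma_eq_0 s) E) as [k ->].
    (* Inversion is not continuous at 0, but the partial products are exactly 0 from index [k] on,
       so their inverses are constantly [/ 0]. *)
    apply Clim_ext_eventually with (fun _ => / 0); [|apply Clim_const].
    exists k. intros N HN. f_equal. destruct k as [|[|j]].
    + simpl. ring.
    + simpl. ring.
    + rewrite (C_partial_prod_eq_0 _ j N); [ring| |lia].
      apply gamma_factor_eq_0. reflexivity.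
  - apply Clim_inv; [exact Hne|apply gamma_partial_prod_Clim].
Qed.

(** The Euler denominators at [s] and [s + 1] share all but their end factors. Hence [s] times the
    partial product at [s + 1] is the one at [s] times (s + N + 2)/(N + 1), which tends to 1. *)
Lemma rGamma_S (s : C) : rGamma s = s * rGamma (s + 1).
Proof.
  destruct (Ceq_or_neq s 0) as [->|Hs].
  { rewrite Cmult_0_l. apply rGamma_eq_0. exists 0%nat. simpl. ring. }
  assert (HS : forall n,
    s * C_partial_prod (fun k => s + 1 + RtoC (INR k)) n
    = C_partial_prod (fun k => s + RtoC (INR k)) (S n)).
  { intros n. induction n as [|n IH]; [simpl; ring|].
    change (C_partial_prod (fun k => s + RtoC (INR k)) (S (S n)))
      with (C_partial_prod (fun k => s + RtoC (INR k)) (S n)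
            * (s + RtoC (INR (S n)))).
    rewrite <- IH. rewrite S_INR, RtoC_plus. simpl. ring. }
  set (P := fun s N => s * (1 + s) * C_partial_prod (fun j => gamma_factor j s) N).
  apply (Clim_unique (fun N => s * P (s + 1) N)).
  2: { apply Clim_mult; [apply Clim_const|apply gamma_partial_prod_Clim]. }
  apply Clim_ext with (fun N => P s N * (1 + (s + 1) * RtoC (/ INR (S N)))).
  - intros N. assert (E := HS (S (S N))).
    change (C_partial_prod (fun k => s + RtoC (INR k)) (S (S (S N))))
      with (C_partial_prod (fun k => s + RtoC (INR k)) (S (S N))
            * (s + RtoC (INR (S (S N))))) in E.
    rewrite !gamma_partial_prod in E. fold (P s N) (P (s + 1) N) in E.
    assert (H1 : 0 < INR (S N)) by (apply lt_0_INR; lia).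
    assert (H1' : RtoC (INR (S N)) <> 0).
    { intros E'. apply RtoC_inj in E'. lra. }
    replace (Rpow_C (INR (S N)) (s + 1)) with (Rpow_C (INR (S N)) s * RtoC (INR (S N))) in E.
    2: { rewrite Rpow_C_plus. f_equal. unfold Rpow_C.
         rewrite Cmult_1_l, Cexp_RtoC, exp_ln by exact H1. reflexivity. }
    rewrite (S_INR (S N)), RtoC_plus in E. rewrite RtoC_inv by lra.
    set (n := RtoC (INR (S N))) in *.
    set (X := RtoC (INR (fact (S N))) * Rpow_C (INR (S N)) s) in *.
    assert (HX : X <> 0).
    { apply Cmult_neq_0; [|apply Rpow_C_neq_0]. intros E'. apply RtoC_inj in E'.
      revert E'. apply INR_fact_neq_0. }
    replace (RtoC (INR (fact (S N))) * (Rpow_C (INR (S N)) s * n)) with (X * n) in E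
      by (unfold X; ring).
    replace (P s N * (1 + (s + 1) * / n))
      with (P s N * X * (s + (n + 1)) / (X * n)) by (field; auto).
    rewrite <- E. field. auto.
  - replace (rGamma s) with (rGamma s * (1 + (s + 1) * 0)) by ring.
    apply Clim_mult; [apply gamma_partial_prod_Clim|].
    apply Clim_plus; [apply Clim_const|]. apply Clim_mult; [apply Clim_const|].
    apply Clim_RtoC, is_lim_seq_inv_INR_S.
Qed.

(** * Wallis' product and Gamma(3/2) *)

Local Open Scope R_scope.

Definition wallis (n : nat) : R := RInt (fun x => sin x ^ n) 0 (PI / 2).

Lemma ex_RInt_sin_pow (n : nat) : ex_RInt (fun x => sin x ^ n) 0 (PI / 2).
Proof.
  apply (ex_RInt_continuous (V := R_CompleteNormedModule)). intros x _.
  apply (ex_derive_continuous (V := R_NormedModule)). auto_derive. exact I.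
Qed.

Lemma wallis_0 : wallis 0 = PI / 2.
Proof.
  unfold wallis. rewrite (RInt_ext _ (fun _ => 1)) by reflexivity.
  rewrite RInt_const. unfold scal; simpl; unfold mult; simpl. ring.
Qed.

Lemma wallis_1 : wallis 1 = 1.
Proof.
  unfold wallis. apply is_RInt_unique.
  evar_last.
  - apply (is_RInt_derive (V := R_CompleteNormedModule) (fun x => - cos x)).
    + intros x _. auto_derive; [exact I|ring].
    + intros x _. apply (ex_derive_continuous (V := R_NormedModule)).
      auto_derive. exact I.
  - unfold minus, plus, opp; simpl. rewrite cos_0, cos_PI2. ring.
Qed.

Lemma wallis_SS (n : nat) : INR (n + 2) * wallis (n + 2) = INR (n + 1) * wallis n.
Proof.
  (* The integrand is the derivative of [- cos x * sin x ^ (n + 1)], which vanishes at both ends. *)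
  assert (H : is_RInt (fun x => INR (n + 2) * sin x ^ (n + 2) - INR (n + 1) * sin x ^ n)
                0 (PI / 2) 0).
  { evar_last.
    - apply (is_RInt_derive (V := R_CompleteNormedModule)
               (fun x => - cos x * sin x ^ (n + 1))).
      + intros x _. auto_derive; [exact I|].
        replace (Nat.pred (n + 1)) with n by lia.
        rewrite !plus_INR, !pow_add. simpl.
        assert (E := sin2_cos2 x). unfold Rsqr in E.
        transitivity ((sin x * sin x - (INR n + 1) * (cos x * cos x)) * sin x ^ n); [ring|].
        replace (cos x * cos x) with (1 - sin x * sin x) by lra. ring.
      + intros x _. apply (ex_derive_continuous (V := R_NormedModule)).
        auto_derive. auto.
    - unfold minus, plus, opp; simpl. rewrite cos_PI2, sin_0, pow_i by lia. ring. }
  assert (H' : is_RInt (fun x => INR (n + 2) * sin x ^ (n + 2) - INR (n + 1) * sin x ^ n)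
                0 (PI / 2) (INR (n + 2) * wallis (n + 2) - INR (n + 1) * wallis n)).
  { apply (is_RInt_minus (V := R_NormedModule));
      apply (is_RInt_scal (V := R_NormedModule));
      apply (RInt_correct (V := R_CompleteNormedModule)), ex_RInt_sin_pow. }
  apply (is_RInt_unique (V := R_CompleteNormedModule)) in H.
  apply (is_RInt_unique (V := R_CompleteNormedModule)) in H'. lra.
Qed.

Lemma wallis_ge_0 (n : nat) : 0 <= wallis n.
Proof.
  apply RInt_ge_0; [generalize PI_RGT_0; lra|apply ex_RInt_sin_pow|].
  intros x Hx. apply pow_le, sin_ge_0; generalize PI_RGT_0; lra.
Qed.

Lemma wallis_decr (n : nat) : wallis (S n) <= wallis n.
Proof.
  apply RInt_le; try apply ex_RInt_sin_pow; [generalize PI_RGT_0; lra|].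
  intros x Hx. simpl.
  assert (H : 0 <= sin x ^ n).
  { apply pow_le, sin_ge_0; generalize PI_RGT_0; lra. }
  generalize (SIN_bound x). nra.
Qed.

Lemma wallis_mult_S (n : nat) : INR (S n) * (wallis n * wallis (S n)) = PI / 2.
Proof.
  induction n as [|n IH].
  - rewrite wallis_0, wallis_1. simpl. ring.
  - rewrite <- IH. assert (E := wallis_SS n).
    replace (n + 2)%nat with (S (S n)) in E by lia.
    replace (n + 1)%nat with (S n) in E by lia.
    replace (INR (S (S n)) * (wallis (S n) * wallis (S (S n))))
      with (wallis (S n) * (INR (S (S n)) * wallis (S (S n)))) by ring.
    rewrite E. ring.
Qed.

(** Monotonicity replaces the outer integrals by [wallis (S n)] in two consecutive instances of the
    constant product [wallis_mult_S]. *)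
Lemma wallis_sqr_bounds (n : nat) :
  INR (S n) * wallis (S n) ^ 2 <= PI / 2 <= INR (S (S n)) * wallis (S n) ^ 2.
Proof.
  assert (H1 := wallis_mult_S n). assert (H2 := wallis_mult_S (S n)).
  assert (D1 := wallis_decr n). assert (D2 := wallis_decr (S n)).
  assert (P := wallis_ge_0 (S n)).
  assert (Q1 := pos_INR (S n)). assert (Q2 := pos_INR (S (S n))).
  split.
  - rewrite <- H1. apply Rmult_le_compat_l; [exact Q1|]. nra.
  - rewrite <- H2. apply Rmult_le_compat_l; [exact Q2|]. nra.
Qed.

(** Successive even integrals have ratio (2k + 1)/(2k + 2) = (1/2 + k)/(k + 1), and [2 / PI]
    normalises by [wallis 0]. *)
Lemma half_partial_prod (n : nat) :
  C_partial_prod (fun k => 1 / 2 + RtoC (INR k))%C n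
  = RtoC (wallis (2 * n) * (2 / PI) * INR (fact n)).
Proof.
  assert (HPI := PI_RGT_0).
  induction n as [|n IH].
  - simpl. rewrite wallis_0. f_equal. field. lra.
  - simpl C_partial_prod. rewrite IH.
    rewrite <- RtoC_div, <- RtoC_plus, <- RtoC_mult by lra. f_equal.
    assert (E := wallis_SS (2 * n)).
    replace (2 * n + 2)%nat with (2 * S n)%nat in E by lia.
    change (fact (S n)) with (S n * fact n)%nat.
    rewrite mult_INR. rewrite (mult_INR 2 (S n)), plus_INR, mult_INR in E.
    change (INR 2) with 2 in E. change (INR 1) with 1 in E.
    replace (wallis (2 * S n) * (2 / PI) * (INR (S n) * INR (fact n)))
      with ((2 * INR (S n) * wallis (2 * S n)) * / 2 * (2 / PI) * INR (fact n)) by (field; lra).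
    rewrite E. field. lra.
Qed.

Lemma rGamma_half : rGamma (1 / 2) = RtoC (/ sqrt PI).
Proof.
  assert (HPI := PI_RGT_0).
  set (w := fun N => INR (S (S N)) * wallis (2 * S (S N)) * (2 / PI) / sqrt (INR (S N))).
  apply (Clim_unique (fun N => RtoC (w N))).
  - apply Clim_ext with (2 := gamma_partial_prod_Clim (1 / 2)).
    intros N. assert (E := gamma_partial_prod (1 / 2) N).
    rewrite half_partial_prod, Rpow_C_half in E by (apply lt_0_INR; lia).
    change (fact (S (S N))) with (S (S N) * fact (S N))%nat in E.
    assert (HF : INR (fact (S N)) <> 0) by apply INR_fact_neq_0.
    assert (HS : sqrt (INR (S N)) <> 0).
    { apply Rgt_not_eq, sqrt_lt_R0, lt_0_INR. lia. }
    assert (HX : (RtoC (INR (fact (S N))) * RtoC (sqrt (INR (S N))))%C <> 0%C).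
    { apply Cmult_neq_0; intros E'; apply RtoC_inj in E'; auto. }
    set (p := (1 / 2 * (1 + 1 / 2) * _)%C) in *.
    replace p with (p * (RtoC (INR (fact (S N))) * RtoC (sqrt (INR (S N))))
                    / (RtoC (INR (fact (S N))) * RtoC (sqrt (INR (S N)))))%C.
    2: { unfold Cdiv. rewrite <- Cmult_assoc, Cinv_r by exact HX. ring. }
    rewrite <- E, <- RtoC_mult, <- RtoC_div by (apply Rmult_integral_contrapositive; auto).
    f_equal. unfold w. rewrite mult_INR. field. repeat split; auto; lra.
  - apply Clim_RtoC.
    assert (Hw0 : forall N, 0 <= w N).
    { intros N. unfold w. apply Rmult_le_pos.
      - repeat apply Rmult_le_pos; try apply pos_INR; try apply wallis_ge_0; try lra.
        left. apply Rinv_0_lt_compat. lra.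
      - left. apply Rinv_0_lt_compat, sqrt_lt_R0, lt_0_INR. lia. }
    (* The Wallis bounds concern squares, so [w N] is squeezed through its square, between 1/pi and
       (1 + 1/(N + 1))/pi. *)
    apply is_lim_seq_ext with (fun N => sqrt (w N * w N)).
    { intros N. apply sqrt_square, Hw0. }
    rewrite <- sqrt_inv.
    apply (is_lim_seq_continuous sqrt).
    { apply continuity_pt_sqrt. left. apply Rinv_0_lt_compat, HPI. }
    apply is_lim_seq_le_le with (fun _ => / PI) (fun N => / PI * (1 + / INR (S N))).
    + intros N. assert (B := wallis_sqr_bounds (S (2 * S N))).
      replace (S (S (2 * S N))) with (2 * S (S N))%nat in B by lia.
      rewrite (S_INR (2 * S (S N))), mult_INR in B. change (INR 2) with 2 in B.
      assert (HN : 0 < INR (S N)) by (apply lt_0_INR; lia).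
      rewrite (S_INR (S N)) in B. unfold w. rewrite (S_INR (S N)).
      generalize dependent (INR (S N)). intros n B HN.
      set (W := wallis (2 * S (S N))) in *.
      replace ((n + 1) * W * (2 / PI) / sqrt n * ((n + 1) * W * (2 / PI) / sqrt n))
        with ((n + 1) * (n + 1) * 4 * W ^ 2 / (PI * PI * (sqrt n * sqrt n)))
        by (field; split; [lra|apply Rgt_not_eq, sqrt_lt_R0, HN]).
      rewrite sqrt_sqrt by lra.
      assert (HPPn : 0 < PI * PI * n) by (apply Rmult_lt_0_compat; [nra|exact HN]).
      assert (HW : 0 <= W ^ 2) by apply pow2_ge_0.
      split; apply Rmult_le_reg_r with (PI * PI * n); try exact HPPn.
      * replace (/ PI * (PI * PI * n)) with (PI * n) by (field; lra).
        replace ((n + 1) * (n + 1) * 4 * W ^ 2 / (PI * PI * n) * (PI * PI * n))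
          with ((n + 1) * (n + 1) * 4 * W ^ 2) by (field; lra).
        nra.
      * replace (/ PI * (1 + / n) * (PI * PI * n)) with (PI * (n + 1)) by (field; lra).
        replace ((n + 1) * (n + 1) * 4 * W ^ 2 / (PI * PI * n) * (PI * PI * n))
          with ((n + 1) * (n + 1) * 4 * W ^ 2) by (field; lra).
        nra.
    + apply is_lim_seq_const.
    + evar_last.
      * apply is_lim_seq_mult'; [apply is_lim_seq_const|].
        apply is_lim_seq_plus'; [apply is_lim_seq_const|apply is_lim_seq_inv_INR_S].
      * simpl. apply f_equal. ring.
Qed.

Lemma rGamma_three_halves : rGamma (3 / 2) = RtoC (2 / sqrt PI).
Proof.
  assert (E := rGamma_S (1 / 2)).
  replace (1 / 2 + 1)%C with (3 / 2)%C in E by field.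
  rewrite rGamma_half in E.
  replace (rGamma (3 / 2)) with (2 * (1 / 2 * rGamma (3 / 2)))%C by field.
  rewrite <- E, <- RtoC_mult. reflexivity.
Qed.

Local Open Scope C_scope.

(** * Poles *)

Lemma ex_derive_locally_bounded (f : C -> C) (z0 : C) :
  ex_derive (K := C_AbsRing) (V := C_NormedModule) f z0 ->
  exists d M : R, 0 < d /\ forall z, Cmod (z - z0) < d -> Cmod (f z) <= M.
Proof.
  intros H. apply ex_derive_continuous in H.
  destruct (H (fun w => Cmod (w - f z0) < 1)) as [d Hd].
  { apply locally_Cmod. exists 1%R. split; [lra|auto]. }
  exists d, (Cmod (f z0) + 1)%R. split; [apply cond_pos|].
  intros z Hz. specialize (Hd z Hz). simpl in Hd.
  generalize (Cmod_triangle (f z0) (f z - f z0)).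
  replace (f z0 + (f z - f z0)) with (f z) by ring. lra.
Qed.

(** [w ^ m] clears all denominators and leaves a polynomial in [w]. *)
Lemma principal_part_bounded (c : nat -> C) (m : nat) :
  exists M : R, 0 <= M /\ forall w : C, w <> 0 -> Cmod w <= 1 ->
    Cmod (w ^ m * sum_n_m (G := C_AbelianMonoid) (fun k => c k / w ^ k) 1 m) <= M.
Proof.
  induction m as [|m (M & HM & IH)].
  - exists 0%R. split; [lra|]. intros w _ _. rewrite sum_n_m_zero by lia.
    change zero with (RtoC 0). rewrite Cmult_0_r, Cmod_0. lra.
  - exists (M + Cmod (c (S m)))%R. split; [generalize (Cmod_ge_0 (c (S m))); lra|].
    intros w Hw Hw1. rewrite sum_n_Sm by lia. change plus with Cplus.
    assert (Hwm := Cpow_nz w m Hw). rewrite Cpow_S.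
    set (s := sum_n_m _ _ _) in *.
    replace (w * w ^ m * (s + c (S m) / (w * w ^ m)))
      with (w * (w ^ m * s) + c (S m)) by (field; auto).
    apply Cmod_plus_le; [|apply Rle_refl].
    rewrite <- (Rmult_1_l M). apply Cmod_mult_le; [exact Hw1|]. apply IH; assumption.
Qed.

(** Multiplied by (z - z0)^m, the expansion writes [c m] as z - z0 times a bounded quantity, since
    [f] and [h] are bounded near [z0]. This excludes poles of [zeta] other than 1. *)
Lemma principal_part_ex_derive (f : C -> C) (z0 : C) (m : nat) (c : nat -> C) :
  ex_derive (K := C_AbsRing) (V := C_NormedModule) f z0 ->
  principal_part f z0 m c -> (1 <= m)%nat -> c m = 0.
Proof.
  intros Hf (h & Hh & Hloc) Hm.
  apply locally_singleton in Hh.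
  destruct (ex_derive_locally_bounded f z0 Hf) as (d1 & M1 & Hd1 & H1).
  destruct (ex_derive_locally_bounded h z0 Hh) as (d2 & M2 & Hd2 & H2).
  apply locally_Cmod in Hloc. destruct Hloc as (d3 & Hd3 & H3).
  destruct m as [|m]; [lia|].
  destruct (principal_part_bounded c m) as (M & HM & HB).
  assert (HM1 : 0 <= M1).
  { eapply Rle_trans; [apply (Cmod_ge_0 (f z0))|]. apply H1.
    replace (z0 - z0) with (RtoC 0) by ring. rewrite Cmod_0. exact Hd1. }
  assert (HM2 : 0 <= M2).
  { eapply Rle_trans; [apply (Cmod_ge_0 (h z0))|]. apply H2.
    replace (z0 - z0) with (RtoC 0) by ring. rewrite Cmod_0. exact Hd2. }
  assert (Key : forall t : R, 0 < t <= 1 -> t < d1 -> t < d2 -> t < d3 ->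
            Cmod (c (S m)) <= t * (M1 + M2 + M)).
  { intros t Ht K1 K2 K3. set (w := RtoC t).
    assert (Hw : Cmod w = t) by (unfold w; rewrite Cmod_R; apply Rabs_pos_eq; lra).
    assert (Hw0 : w <> 0) by (apply Cmod_gt_0; lra).
    assert (E : z0 + w - z0 = w) by ring.
    assert (Eq : f (z0 + w)
      = sum_n_m (G := C_AbelianMonoid) (fun k => c k / (z0 + w - z0) ^ k) 1 (S m)
        + h (z0 + w)).
    { apply H3; [rewrite E; lra|]. intros E'. apply Hw0. rewrite <- E, E'. ring. }
    rewrite E, sum_n_Sm in Eq by lia. change plus with Cplus in Eq.
    specialize (HB w Hw0 ltac:(lra)).
    set (s := sum_n_m _ _ _) in *.
    assert (Hwm := Cpow_nz w m Hw0). rewrite Cpow_S in Eq.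
    replace (c (S m))
      with (w * (w ^ m * (f (z0 + w) + - h (z0 + w)) + - (w ^ m * s))).
    2: { rewrite Eq. field. auto. }
    rewrite <- Hw. apply Cmod_mult_le; [apply Rle_refl|].
    apply Cmod_plus_le; [|rewrite Cmod_opp; exact HB].
    rewrite <- (Rmult_1_l (M1 + M2)). apply Cmod_mult_le.
    - rewrite Cmod_pow, Hw. rewrite <- (pow1 m). apply pow_incr. lra.
    - apply Cmod_plus_le; [apply H1|rewrite Cmod_opp; apply H2]; rewrite E; lra. }
  apply Cmod_eq_0. apply Rle_antisym; [|apply Cmod_ge_0].
  apply Rnot_lt_le. intros Hpos.
  set (S0 := (M1 + M2 + M + 1)%R).
  assert (HS0 : 0 < S0) by (unfold S0; lra).
  assert (Hcs : 0 < Cmod (c (S m)) / S0) by (apply Rdiv_lt_0_compat; assumption).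
  (* [t] lies below all radii and below [Cmod (c (S m)) / S0], which contradicts [Key]; halving
     makes these inequalities strict. *)
  set (t := (Rmin (Rmin 1 (Cmod (c (S m)) / S0)) (Rmin d1 (Rmin d2 d3)) / 2)%R).
  assert (B1 := Rmin_l (Rmin 1 (Cmod (c (S m)) / S0)) (Rmin d1 (Rmin d2 d3))).
  assert (B2 := Rmin_r (Rmin 1 (Cmod (c (S m)) / S0)) (Rmin d1 (Rmin d2 d3))).
  assert (B3 := Rmin_l 1 (Cmod (c (S m)) / S0)).
  assert (B4 := Rmin_r 1 (Cmod (c (S m)) / S0)).
  assert (B5 := Rmin_l d1 (Rmin d2 d3)). assert (B6 := Rmin_r d1 (Rmin d2 d3)).
  assert (B7 := Rmin_l d2 d3). assert (B8 := Rmin_r d2 d3).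
  assert (Ht : 0 < t).
  { unfold t. apply Rdiv_lt_0_compat; [|lra]. repeat apply Rmin_glb_lt; lra. }
  assert (Ht2 : t < Cmod (c (S m)) / S0) by (unfold t in *; lra).
  assert (K := Key t ltac:(unfold t in *; lra) ltac:(unfold t in *; lra)
                 ltac:(unfold t in *; lra) ltac:(unfold t in *; lra)).
  apply Rmult_lt_compat_r with (r := S0) in Ht2; [|exact HS0].
  replace (Cmod (c (S m)) / S0 * S0)%R with (Cmod (c (S m))) in Ht2 by (field; lra).
  assert (t * (M1 + M2 + M) <= t * S0).
  { apply Rmult_le_compat_l; [lra|unfold S0; lra]. }
  lra.
Qed.

(** * The product over a Riemann sequence *)

Lemma Re_ge_first (alpha : nat -> C) (n : nat) : riemann_sequence alpha -> 1 < Re (alpha n).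
Proof.
  intros H. induction n as [|n IH]; [apply rs_gt1, H|].
  eapply Rlt_le_trans; [exact IH|apply rs_mono, H].
Qed.

Lemma ex_series_Re (u : nat -> C) (l : C) :
  is_series (V := C_NormedModule) u l -> ex_series (fun n => Re (u n)).
Proof.
  intros H. exists (Re l).
  assert (H' := proj1 (filterlim_locally_Cmod eventually _ _) H).
  change (is_lim_seq (sum_n (fun n => Re (u n))) (Re l)).
  apply is_lim_seq_spec. intros eps. generalize (H' eps (cond_pos eps)).
  apply filter_imp. intros n Hn. eapply Rle_lt_trans; [|exact Hn].
  replace (sum_n (fun k => Re (u k)) n) with (Re (sum_n (G := C_NormedModule) u n)).
  - apply (re_le_Cmod (sum_n (G := C_NormedModule) u n - l)).
  - clear. induction n as [|n IH]; [rewrite !sum_O; reflexivity|].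
    rewrite !sum_Sn, <- IH. reflexivity.
Qed.

Lemma ex_series_inv_Re_sqr (alpha : nat -> C) :
  riemann_sequence alpha -> ex_series (fun n => / (Re (alpha n) ^ 2))%R.
Proof.
  intros Hrs. destruct (rs_strip _ Hrs) as [K0 HK0].
  destruct (rs_expansion _ Hrs) as (E & B & a & F & _ & _ & HF & _).
  (* [x] lies in the half-plane of convergence, and [x >= K0] gives [q * q <= x * x], so the real
     part [x * x + (p * p - q * q)] of the denominator is at least [p * p]. *)
  set (x := Rmax (a + 1) (Rmax 1 K0)).
  assert (Hx1 : a + 1 <= x) by apply Rmax_l.
  assert (Hx2 : 1 <= x) by (eapply Rle_trans; [apply Rmax_l|apply Rmax_r]).
  assert (Hx3 : K0 <= x) by (eapply Rle_trans; [apply Rmax_r|apply Rmax_r]).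
  assert (Hs := HF (RtoC x) ltac:(simpl; lra)).
  apply ex_series_Re in Hs.
  (* With A + i D the denominator, a term has real part 2 x A/(A^2 + D^2). From D^2 <= 4 x^2 A, A <=
     p^2 + x^2 and p > 1 follows A^2 + D^2 <= A (5 x^2 + 1) p^2, whence this constant. *)
  apply (ex_series_scal (V := R_NormedModule) ((5 * x ^ 2 + 1) / (2 * x))%R) in Hs.
  revert Hs. apply (ex_series_le (V := R_CompleteNormedModule)).
  intros n. change norm with Rabs.
  assert (Hp := Re_ge_first alpha n Hrs). assert (Hq := HK0 n).
  change scal with Rmult. cbv beta.
  destruct (alpha n) as [p q]. change (Re (p, q)) with p in *.
  change (Im (p, q)) with q in Hq.
  set (A := (x * x + (p * p - q * q))%R). set (D := (2 * p * q)%R).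
  replace (2 * RtoC x / (RtoC x ^ 2 + (p, q) ^ 2)) with (RtoC (2 * x) / (A, D)).
  2: { rewrite RtoC_mult. f_equal. unfold A, D. apply injective_projections; simpl; ring. }
  assert (Hq2 : q * q <= x * x).
  { replace (q * q)%R with (Rabs q * Rabs q)%R by (rewrite <- Rabs_mult; apply Rabs_pos_eq; nra).
    generalize (Rabs_pos q). nra. }
  assert (Hp2 : 1 <= p * p) by nra.
  assert (Hx4 : 1 <= x * x) by nra.
  assert (HA : p * p <= A) by (unfold A; lra).
  assert (HA' : A <= p * p + x * x) by (unfold A; nra).
  assert (HD : D * D <= 4 * (x * x) * A).
  { unfold D. replace (2 * p * q * (2 * p * q))%R with (4 * (q * q * (p * p)))%R by ring.
    assert (q * q * (p * p) <= x * x * A) by (apply Rmult_le_compat; nra). lra. }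
  replace (Re (RtoC (2 * x) / (A, D))) with (2 * x * A / (A * A + D * D))%R.
  2: { simpl. field. nra. }
  assert (HAD : 0 < A * A + D * D) by nra.
  rewrite Rabs_pos_eq by (left; apply Rinv_0_lt_compat; simpl; nra).
  replace (/ p ^ 2)%R with ((A * A + D * D) / (p * p) * / (A * A + D * D))%R
    by (field; split; nra).
  replace ((5 * x ^ 2 + 1) / (2 * x) * (2 * x * A / (A * A + D * D)))%R
    with ((5 * (x * x) + 1) * A * / (A * A + D * D))%R by (field; split; nra).
  apply Rmult_le_compat_r; [left; apply Rinv_0_lt_compat, HAD|].
  apply Rmult_le_reg_r with (p * p)%R; [lra|].
  replace ((A * A + D * D) / (p * p) * (p * p))%R with (A * A + D * D)%R by (field; nra).
  apply Rle_trans with (A * (p * p + 5 * (x * x)))%R; [nra|].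
  replace ((5 * (x * x) + 1) * A * (p * p))%R
    with (A * (p * p + 5 * (x * x) * (p * p)))%R by ring.
  apply Rmult_le_compat_l; nra.
Qed.

Lemma Cmod_inv_sqr_le (alpha : nat -> C) (n : nat) :
  riemann_sequence alpha ->
  alpha n <> 0 /\ Cmod (/ alpha n ^ 2) <= / (Re (alpha n) ^ 2).
Proof.
  intros Hrs. assert (Hp := Re_ge_first alpha n Hrs).
  assert (Hm := re_le_Cmod (alpha n)). rewrite Rabs_pos_eq in Hm by lra.
  assert (H0 : alpha n <> 0) by (apply Cmod_gt_0; lra).
  split; [exact H0|].
  rewrite Cmod_inv, Cmod_pow by (apply Cpow_nz, H0).
  apply Rinv_le_contravar; [apply pow_lt; lra|]. apply pow_incr. lra.
Qed.

(** A factor is a quadratic polynomial in [s], so its jet is exact: the coefficients are those of (w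
    + t)^2 divided by [alpha n ^ 2], and the remainder is 0. *)
Lemma zeta_factor_jets (alpha : nat -> C) (z0 : C) :
  riemann_sequence alpha ->
  exists (c a b : nat -> C) (d : nat -> R),
    summable_jets (fun n s => zeta_factor alpha s n) z0 c a b d.
Proof.
  intros Hrs. set (w := z0 - 1 / 2). set (A := Cmod w).
  assert (HA : 0 <= A) by apply Cmod_ge_0.
  exists (fun n => w * w * / alpha n ^ 2), (fun n => 2 * w * / alpha n ^ 2),
    (fun n => / alpha n ^ 2), (fun n => (A * A + 2 * A + 1) * / (Re (alpha n) ^ 2))%R.
  split.
  { apply (ex_series_scal (V := R_NormedModule)), ex_series_inv_Re_sqr, Hrs. }
  intros n. destruct (Cmod_inv_sqr_le alpha n Hrs) as [H0 Hn].
  set (x := / alpha n ^ 2) in *. set (y := (/ (Re (alpha n) ^ 2))%R) in *.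
  assert (Hx := Cmod_ge_0 x).
  assert (Hy : forall u v, v <= u -> u <= A * A + 2 * A + 1 ->
            0 <= u -> v * Cmod x <= (A * A + 2 * A + 1) * y).
  { intros u v Hv Hu Hu0. apply Rle_trans with (u * Cmod x)%R.
    - apply Rmult_le_compat_r; assumption.
    - apply Rmult_le_compat; assumption. }
  assert (HAA : 0 <= A * A) by nra.
  split; [|split; [|split]].
  - rewrite Cmod_mult. apply Hy with (A * A)%R; [|lra|lra].
    rewrite Cmod_mult. fold A. lra.
  - rewrite Cmod_mult. apply Hy with (2 * A)%R; [|lra|lra].
    rewrite Cmod_mult, Cmod_R, Rabs_pos_eq by lra. fold A. lra.
  - rewrite <- (Rmult_1_l (Cmod x)). apply Hy with 1%R; lra.
  - apply jet_weaken with 1%R 0%R; [lra|apply Rmult_le_pos; [nra|lra]|].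
    apply jet_poly. intros t. unfold zeta_factor, Cdiv. fold x.
    replace ((z0 + t - 1 * / 2) ^ 2) with ((w + t) * (w + t)) by (unfold w; field).
    ring.
Qed.

Lemma zeta_factor_infprod (alpha : nat -> C) (s : C) :
  riemann_sequence alpha ->
  is_infprod (zeta_factor alpha s) (infprod (zeta_factor alpha s)).
Proof.
  intros Hrs. destruct (zeta_factor_jets alpha s Hrs) as (c & a & b & d & H).
  destruct (summable_jets_center _ _ _ _ _ _ H) as (Hd & Hs).
  destruct (ex_is_infprod _ _ Hs Hd) as [l Hl].
  change (is_infprod (zeta_factor alpha s) l) in Hl.
  rewrite (is_infprod_unique _ _ Hl). exact Hl.
Qed.

Lemma zeta_factor_eq_0 (alpha : nat -> C) (s : C) (n : nat) :
  alpha n <> 0 ->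
  zeta_factor alpha s n = 0 <->
  s = 1 / 2 + Ci * alpha n \/ s = 1 / 2 - Ci * alpha n.
Proof.
  intros H0.
  assert (E : zeta_factor alpha s n
    = (s - (1 / 2 + Ci * alpha n)) * (s - (1 / 2 - Ci * alpha n)) * / alpha n ^ 2).
  { unfold zeta_factor.
    replace ((s - (1 / 2 + Ci * alpha n)) * (s - (1 / 2 - Ci * alpha n)))
      with ((s - 1 / 2) ^ 2 - Ci * Ci * alpha n ^ 2) by ring.
    rewrite Ci_sqr. field. exact H0. }
  assert (Hi : / alpha n ^ 2 <> 0).
  { intros Ei. assert (P := Cinv_r _ (Cpow_nz _ 2 H0)). rewrite Ei, Cmult_0_r in P.
    apply RtoC_inj in P. lra. }
  rewrite E. split.
  - intros Hz.
    destruct (Ceq_or_neq (s - (1 / 2 + Ci * alpha n)) 0) as [E1|H1].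
    { left. replace s with (s - (1 / 2 + Ci * alpha n) + (1 / 2 + Ci * alpha n)) by ring.
      rewrite E1. ring. }
    destruct (Ceq_or_neq (s - (1 / 2 - Ci * alpha n)) 0) as [E2|H2].
    { right. replace s with (s - (1 / 2 - Ci * alpha n) + (1 / 2 - Ci * alpha n)) by ring.
      rewrite E2. ring. }
    exfalso. revert Hz. repeat apply Cmult_neq_0; assumption.
  - intros [->| ->]; ring.
Qed.

Lemma zeta_infprod_eq_0 (alpha : nat -> C) (s : C) :
  riemann_sequence alpha ->
  infprod (zeta_factor alpha s) = 0 <->
  exists n : nat, s = 1 / 2 + Ci * alpha n \/ s = 1 / 2 - Ci * alpha n.
Proof.
  intros Hrs.
  assert (H0 : forall n, alpha n <> 0) by (intros n; apply Cmod_inv_sqr_le, Hrs).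
  split.
  - intros E. apply NNPP. intros Hno.
    destruct (zeta_factor_jets alpha s Hrs) as (c & a & b & d & H).
    destruct (summable_jets_center _ _ _ _ _ _ H) as (Hd & Hs).
    revert E. apply (is_infprod_neq_0 _ d _ Hs Hd); [|apply zeta_factor_infprod, Hrs].
    intros n En. apply Hno. exists n. apply zeta_factor_eq_0; auto.
  - intros [n Hn].
    apply (is_infprod_eq_0 (zeta_factor alpha s) n); [|apply zeta_factor_infprod, Hrs].
    apply zeta_factor_eq_0; auto.
Qed.

Lemma infprod_zeta_factor_reflect (alpha : nat -> C) (s : C) :
  infprod (zeta_factor alpha (1 - s)) = infprod (zeta_factor alpha s).
Proof.
  f_equal. apply functional_extensionality. intros n.
  unfold zeta_factor. do 2 f_equal. field.
Qed.

(** * The zeta function *)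

Definition zeta_num (alpha : nat -> C) (s : C) : C :=
  RtoC (Xi0 alpha) * Rpow_C PI (s / 2) * rGamma (1 + s / 2)
    * infprod (zeta_factor alpha s).

(** Valid at every [s], including 1 and the poles of Gamma(1 + s/2): under [/ 0 = 0] inversion is
    multiplicative and involutive everywhere. *)
Lemma zeta_eq (alpha : nat -> C) (s : C) : zeta alpha s = zeta_num alpha s * / (s - 1).
Proof.
  assert (Hinv : forall z : C, / / z = z).
  { intros z. destruct (Ceq_or_neq z 0) as [->|Hz]; [now rewrite !Cinv_0|].
    rewrite <- (Cmult_1_r (/ / z)), <- (Cinv_l z Hz), Cmult_assoc, Cinv_l by
      (intros E; generalize (Cinv_r z Hz); rewrite E, Cmult_0_r; intros P;
       apply RtoC_inj in P; lra).
    ring. }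
  unfold zeta, zeta_num, Cdiv. rewrite Gamma_rGamma, Cinv_mult, Hinv. ring.
Qed.

Lemma Xi0_neq_0 (alpha : nat -> C) : RtoC (Xi0 alpha) <> 0.
Proof.
  intros E. apply RtoC_inj in E. unfold Xi0 in E.
  generalize (exp_pos (1 / 4 * ln (PI / 2) - Re (Xi_limit alpha))). lra.
Qed.

Lemma taylor2_zeta_num (alpha : nat -> C) (z0 : C) :
  riemann_sequence alpha -> taylor2 (zeta_num alpha) z0.
Proof.
  intros Hrs. unfold zeta_num.
  apply taylor2_mult; [apply taylor2_mult; [apply taylor2_mult|]|].
  - apply taylor2_const.
  - apply taylor2_ext with (fun s => Cexp (RtoC (ln PI) / 2 * s)).
    { intros s. unfold Rpow_C. f_equal. field. }
    apply taylor2_Cexp_linear.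
  - apply taylor2_ext with (fun s => rGamma (/ 2 * s + 1)).
    { intros s. f_equal. field. }
    apply (taylor2_comp_affine rGamma); [|apply taylor2_rGamma].
    rewrite <- RtoC_inv, Cmod_R, Rabs_pos_eq by lra. lra.
  - destruct (zeta_factor_jets alpha z0 Hrs) as (c & a & b & d & H).
    apply (infprod_taylor2 _ _ _ _ _ _ _ H). intros z. apply zeta_factor_infprod, Hrs.
Qed.

(** pi^(1/2) cancels against 1/Gamma(3/2) = 2/sqrt(pi), and the 2 survives. *)
Lemma zeta_num_1 (alpha : nat -> C) :
  zeta_num alpha 1 = 2 * RtoC (Xi0 alpha) * infprod (fun n => 1 + 1 / (4 * alpha n ^ 2)).
Proof.
  unfold zeta_num.
  replace (1 + 1 / 2) with (3 / 2) by field.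
  rewrite rGamma_three_halves, Rpow_C_half by apply PI_RGT_0.
  replace (infprod (fun n => 1 + 1 / (4 * alpha n ^ 2)))
    with (infprod (zeta_factor alpha 1)).
  - rewrite <- (Cmult_assoc (RtoC (Xi0 alpha))), <- RtoC_mult.
    replace (sqrt PI * (2 / sqrt PI))%R with 2%R; [ring|].
    field. apply Rgt_not_eq, sqrt_lt_R0, PI_RGT_0.
  - f_equal. apply functional_extensionality. intros n.
    unfold zeta_factor. f_equal.
    replace ((1 - 1 / 2) ^ 2) with (1 / 4) by field.
    unfold Cdiv. rewrite Cinv_mult. ring.
Qed.

Lemma zeta_num_1_neq_0 (alpha : nat -> C) : riemann_sequence alpha -> zeta_num alpha 1 <> 0.
Proof.
  intros Hrs. unfold zeta_num.
  apply Cmult_neq_0; [apply Cmult_neq_0; [apply Cmult_neq_0|]|].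
  - apply Xi0_neq_0.
  - apply Rpow_C_neq_0.
  - intros E. apply rGamma_eq_0 in E. destruct E as [k E].
    apply (f_equal Re) in E. simpl in E. generalize (pos_INR k). lra.
  (* A vanishing product would give 1 = 1/2 + i alpha or 1 = 1/2 - i alpha for some term; imaginary
     parts then force real part 0, whereas it exceeds 1. *)
  - intros E. apply zeta_infprod_eq_0 in E; [|exact Hrs]. destruct E as [n E].
    assert (Hp := Re_ge_first alpha n Hrs).
    destruct (alpha n) as [p q]. simpl in Hp.
    destruct E as [E|E]; apply (f_equal Im) in E; simpl in E; lra.
Qed.

Lemma ex_derive_zeta (alpha : nat -> C) (s : C) :
  riemann_sequence alpha -> s <> 1 ->
  ex_derive (K := C_AbsRing) (V := C_NormedModule) (zeta alpha) s.
Proof.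
  intros Hrs Hs. apply taylor2_ex_derive.
  apply taylor2_ext with (fun s => zeta_num alpha s * / (s - 1)).
  { intros z. symmetry. apply zeta_eq. }
  apply taylor2_mult; [apply taylor2_zeta_num, Hrs|apply taylor2_inv_sub, Hs].
Qed.

Lemma holomorphic_at_zeta (alpha : nat -> C) (s : C) :
  riemann_sequence alpha -> s <> 1 -> holomorphic_at (zeta alpha) s.
Proof.
  intros Hrs Hs. apply locally_Cmod. exists (Cmod (s - 1)). split.
  - apply Cmod_gt_0, Csub_neq_0, Hs.
  - intros z Hz. apply ex_derive_zeta; [exact Hrs|]. intros ->.
    rewrite <- Cmod_opp in Hz. replace (- (1 - s)) with (s - 1) in Hz by ring. lra.
Qed.

Lemma principal_part_zeta_1 (alpha : nat -> C) :
  riemann_sequence alpha -> principal_part (zeta alpha) 1 1 (fun _ => zeta_num alpha 1).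
Proof.
  intros Hrs.
  destruct (taylor2_difference_quotient (zeta_num alpha) 1
              (fun z => taylor2_zeta_num alpha z Hrs)) as (h & Hd & Hh).
  exists h. split.
  - apply locally_Cmod. exists 1%R. split; [lra|]. intros z _. apply Hd.
  - apply locally_Cmod. exists 1%R. split; [lra|]. intros z _ Hz.
    assert (Hz1 := Csub_neq_0 z 1 Hz).
    rewrite sum_n_n, zeta_eq, (Hh z), Cpow_1_r. field. exact Hz1.
Qed.

Lemma zeta_num_eq_0 (alpha : nat -> C) (s : C) :
  riemann_sequence alpha ->
  zeta_num alpha s = 0 <->
    (exists k : nat, (1 <= k)%nat /\ s = - RtoC (2 * INR k)) \/
    (exists n : nat, s = 1 / 2 + Ci * alpha n \/ s = 1 / 2 - Ci * alpha n).
Proof.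
  intros Hrs. rewrite <- (zeta_infprod_eq_0 alpha s Hrs).
  assert (HG : rGamma (1 + s / 2) = 0 <->
               exists k : nat, (1 <= k)%nat /\ s = - RtoC (2 * INR k)).
  { rewrite rGamma_eq_0. split.
    (* The zero 1 + s/2 = -k gives s = -2 (k + 1); the shift keeps s = 0 out of the trivial
       zeros. *)
    - intros [k Hk]. exists (S k). split; [lia|].
      replace s with (2 * (1 + s / 2) - 2) by field.
      rewrite Hk, S_INR, RtoC_mult, RtoC_plus. ring.
    - intros ([|k] & Hk & ->); [lia|]. exists k.
      rewrite S_INR, RtoC_mult, RtoC_plus. field. }
  rewrite <- HG. unfold zeta_num. split.
  - intros E.
    destruct (Ceq_or_neq (rGamma (1 + s / 2)) 0) as [E1|H1]; [left; exact E1|right].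
    destruct (Ceq_or_neq (infprod (zeta_factor alpha s)) 0) as [E2|H2]; [exact E2|].
    exfalso. revert E. apply Cmult_neq_0; [apply Cmult_neq_0|]; try assumption.
    apply Cmult_neq_0; [apply Xi0_neq_0|apply Rpow_C_neq_0].
  - intros [-> | ->]; ring.
Qed.

(** Gamma(s/2) against 1/Gamma(1 + s/2) leaves 2/s. Both [s * (s - 1)] and the product are invariant
    under s -> 1 - s, so using this identity at both points gives the functional equation. *)
Lemma completed_zeta (alpha : nat -> C) (s : C) :
  ~ is_Gamma_pole (s / 2) -> s <> 1 ->
  Rpow_C PI (- s / 2) * Gamma (s / 2) * zeta alpha s
  = 2 * RtoC (Xi0 alpha) * infprod (zeta_factor alpha s) / (s * (s - 1)).
Proof.
  intros Hp Hs.
  assert (Hs1 := Csub_neq_0 s 1 Hs).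
  assert (Hs0 : s <> 0).
  { intros ->. apply Hp. exists 0%nat. simpl. field. }
  rewrite <- rGamma_eq_0, rGamma_S, (Cplus_comm (s / 2)) in Hp.
  rewrite Gamma_rGamma, rGamma_S, (Cplus_comm (s / 2)), zeta_eq. unfold zeta_num.
  assert (Hg : rGamma (1 + s / 2) <> 0).
  { intros E. apply Hp. rewrite E. ring. }
  assert (HR : Rpow_C PI (- s / 2) * Rpow_C PI (s / 2) = 1).
  { rewrite <- Rpow_C_plus. replace (- s / 2 + s / 2) with (RtoC 0) by field.
    unfold Rpow_C. rewrite Cmult_0_l. apply Cexp_0. }
  transitivity ((Rpow_C PI (- s / 2) * Rpow_C PI (s / 2))
    * (2 * RtoC (Xi0 alpha) * infprod (zeta_factor alpha s) / (s * (s - 1)))).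
  - field. auto.
  - rewrite HR. ring.
Qed.

Theorem theorem21 :
  forall (alpha : nat -> C) (K : R),
    riemann_sequence alpha ->
    (forall n : nat, (Rabs (Im (alpha n)) < K)%R) ->
    (* the product defining zeta converges at every point *)
    (forall s : C, exists l : C, is_infprod (zeta_factor alpha s) l) /\
    (* zeta is meromorphic, with a unique pole, simple, at 1 *)
    meromorphic (zeta alpha) /\
    (forall s : C, s <> 1 -> holomorphic_at (zeta alpha) s) /\
    (forall s : C, is_pole (zeta alpha) s <-> s = 1) /\
    pole_of_order (zeta alpha) 1 1 /\
    is_residue (zeta alpha) 1
      (2 * RtoC (Xi0 alpha) * infprod (fun n => 1 + 1 / (4 * alpha n ^ 2))) /\
    (* zeros *)
    (forall s : C, s <> 1 ->
       (zeta alpha s = 0 <->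
          (exists k : nat, (1 <= k)%nat /\ s = - RtoC (2 * INR k)) \/
          (exists n : nat, s = 1 / 2 + Ci * alpha n \/
                           s = 1 / 2 - Ci * alpha n))) /\
    (forall n : nat,
       (Rabs (Re (1 / 2 + Ci * alpha n) - 1 / 2) < K)%R /\
       (Rabs (Re (1 / 2 - Ci * alpha n) - 1 / 2) < K)%R) /\
    (* functional equation, away from the poles of the Gamma factors *)
    (forall s : C, ~ is_Gamma_pole (s / 2) -> ~ is_Gamma_pole ((1 - s) / 2) ->
       Rpow_C PI (- s / 2) * Gamma (s / 2) * zeta alpha s
       = Rpow_C PI (- (1 - s) / 2) * Gamma ((1 - s) / 2) * zeta alpha (1 - s)).
Proof.
  intros alpha K Hrs HK.
  assert (Hpole : pole_of_order (zeta alpha) 1 1).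
  { split; [lia|]. exists (fun _ => zeta_num alpha 1).
    split; [apply principal_part_zeta_1, Hrs|apply zeta_num_1_neq_0, Hrs]. }
  split; [|split; [|split; [|split; [|split; [|split; [|split; [|split]]]]]]].
  - intros s. eexists. apply zeta_factor_infprod, Hrs.
  - intros z0. destruct (Ceq_or_neq z0 1) as [->|Hz].
    + do 2 eexists. apply principal_part_zeta_1, Hrs.
    + exists 0%nat, (fun _ => RtoC 0), (zeta alpha).
      split; [apply holomorphic_at_zeta; assumption|].
      apply locally_Cmod. exists 1%R. split; [lra|]. intros z _ _.
      rewrite sum_n_m_zero by lia. change zero with (RtoC 0). ring.
  - intros s Hs. apply holomorphic_at_zeta; assumption.
  - intros s. split.
    + intros (m & Hm & c & Hc & Hcm). destruct (Ceq_or_neq s 1) as [E|Hs]; [exact E|].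
      exfalso. apply Hcm. apply (principal_part_ex_derive (zeta alpha) s); try assumption.
      apply ex_derive_zeta; assumption.
    + intros ->. exists 1%nat. exact Hpole.
  - exact Hpole.
  - exists 1%nat, (fun _ => zeta_num alpha 1). split; [lia|].
    split; [apply principal_part_zeta_1, Hrs|apply zeta_num_1].
  - intros s Hs. rewrite <- zeta_num_eq_0, zeta_eq by exact Hrs.
    assert (Hs1 := Csub_neq_0 s 1 Hs).
    split; [|intros ->; ring]. intros E.
    replace (zeta_num alpha s) with (zeta_num alpha s * / (s - 1) * (s - 1))
      by (field; exact Hs1).
    rewrite E. ring.
  - intros n. specialize (HK n). destruct (alpha n) as [p q]. simpl in HK.
    (* Multiplication by i turns the imaginary part of [alpha n] into the displacement from the line
       Re s = 1/2, up to sign. *)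
    assert (H1 : (Re (1 / 2 + Ci * (p, q)) - 1 / 2)%R = (- q)%R) by (simpl; field).
    assert (H2 : (Re (1 / 2 - Ci * (p, q)) - 1 / 2)%R = q) by (simpl; field).
    rewrite H1, H2, Rabs_Ropp. auto.
  - intros s H1 H2.
    (* The poles with [k = 0] of the two Gamma factors are s = 0 and s = 1; excluding them is what
       [completed_zeta] requires at [s] and at [1 - s]. *)
    assert (Hs1 : s <> 1).
    { intros ->. apply H2. exists 0%nat. simpl. field. }
    assert (Hs0 : 1 - s <> 1).
    { intros E. apply H1. exists 0%nat. simpl.
      replace s with (1 - (1 - s)) by ring. rewrite E. field. }
    rewrite !completed_zeta, infprod_zeta_factor_reflect by assumption.
    f_equal. ring.
Qed.
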